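(* Let $d$ be a positive integer, let $\nu\in\mathbb{Q}$ and write $\nu=[a_0;a_1,\ldots,a_n]$ as a finite continued fraction. Let $\mathcal{M}$ be a sub-$S_\nu$-module of $S_\nu^d$. Then $\mathrm{Max}(\mathcal{M})$ is generated, as an $S_\nu$-module, by at most $$d\cdot\Big(2+\sum_{i=1}^{\lfloor n/2\rfloor}a_{2i}\Big)$$ elements.
   Context: $R$ is a complete discrete valuation ring with uniformizer $\pi$ and fraction field $K$; $v_K$ is the valuation on $K$ with $v_K(\pi)=1$. Write $\nu=\beta/\alpha$ with $\alpha\ge1$ and $\alpha,\beta$ coprime integers. $S_\nu=\{\sum_{i\ge 0}a_iu^i\in K[[u]] : v_K(a_i)+\nu i\ge 0\ \forall i\}$. $[a_0;a_1,\ldots,a_n]=a_0+\cfrac{1}{a_1+\cfrac{1}{\ddots+\cfrac1{a_n}}}$ with $a_0\in\mathbb{Z}$ and $a_1,\ldots,a_n$ positive integers; the expansion is normalized so that $a_n\ne1$ (when $n\ge1$), which makes it unique. A morphism of finitely generated $S_\nu$-modules is a quasi-isomorphism if its kernel and cokernel have finite length. For a finitely generated torsion-free $S_\nu$-module $\mathcal{M}$, $\mathrm{Max}(\mathcal{M})$ is the finitely generated torsion-free module (unique up to isomorphism) equipped with a quasi-isomorphism $f:\mathcal{M}\to\mathrm{Max}(\mathcal{M})$ such that for every finitely generated torsion-free $\mathcal{N}$ and every quasi-isomorphism $f':\mathcal{M}\to\mathcal{N}$ there is $g:\mathcal{N}\to\mathrm{Max}(\mathcal{M})$ with $g\circ f'=f$.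 For $\mathcal{M}\subset S_\nu^d$ it is realized as $\{x\in S_\nu^d:\exists n\in\mathbb{N},\ \pi^nx\in\mathcal{M}\text{ and }(u^\alpha/\pi^\beta)^nx\in\mathcal{M}\}$. *)

(* Defs.v *)
From HB Require Import structures.
From mathcomp Require Import all_boot all_order all_algebra.
From mathcomp Require Import fraction.
From mathcomp Require Import boolp classical_sets constructive_ereal.

Set Implicit Arguments.
Unset Strict Implicit.
Unset Printing Implicit Defensive.

Import Order.TTheory GRing.Theory Num.Theory.
Local Open Scope ring_scope.

Notation "x %:F" := (@FracField.tofrac _ x) : ring_scope.

Definition rdvd (R : comNzRingType) (a x : R) : Prop := exists c, x = c * a.

(* A principal ideal domain whose non-units form the nonzero ideal generated
   by the uniformizer, complete for the topology defined by this ideal.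
   The ideals of R are the submodules of R^o. *)
HB.mixin Record IntegralDomain_isCompleteDVR R of GRing.IntegralDomain R := {
  uniformizer : R;
  uniformizer_neq0 : uniformizer != 0;
  nonunit_uniformizer : forall x : R,
    (x \isn't a GRing.unit) <-> rdvd uniformizer x;
  dvr_principal : forall I : {pred R^o}, GRing.submod_closed I ->
    exists a : R, forall x : R, x \in I <-> rdvd a x;
  dvr_complete : forall s : nat -> R,
    (forall m, exists N, forall i j, (N <= i)%N -> (N <= j)%N ->
       rdvd (uniformizer ^+ m) (s i - s j)) ->
    exists l, forall m, exists N, forall i, (N <= i)%N ->
       rdvd (uniformizer ^+ m) (s i - l)
}.

#[short(type="completeDvrType")]
HB.structure Definition CompleteDVR :=
  { R of GRing.IntegralDomain R & IntegralDomain_isCompleteDVR R }.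

Section Valuation.
Variable R : completeDvrType.
Local Notation K := {fraction R}.
Local Notation pi := (@uniformizer R).
Implicit Types (r : R) (x y : K).

Lemma uniformizer_nonunit : (pi : R) \isn't a GRing.unit.
Proof. by apply/nonunit_uniformizer; exists 1; rewrite mul1r. Qed.

Lemma uniformizerX_neq0 k : pi ^+ k != 0 :> R.
Proof. by rewrite expf_neq0 // uniformizer_neq0. Qed.

Lemma uniformizerF_neq0 : pi%:F != 0 :> K.
Proof. by rewrite tofrac_eq0 uniformizer_neq0. Qed.

Lemma uniformizerFX_neq0 (m : int) : pi%:F ^ m != 0 :> K.
Proof. by rewrite expfz_neq0 // uniformizerF_neq0. Qed.

Lemma dvr_factor r : r != 0 ->
  exists2 e : R, e \is a GRing.unit & exists k : nat, r = e * pi ^+ k.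
Proof.
move=> r0.
pose I : {pred R^o} := [pred z : R^o | `[< exists (k : nat) (c : R),
  (z : R) * pi ^+ k = c * r >]].
have subI : GRing.submod_closed I.
  split; first by apply/asboolP; exists 0%N, 0; rewrite !mul0r.
  move=> a u v /asboolP[k1 [c1 e1]] /asboolP[k2 [c2 e2]]; apply/asboolP.
  exists (k1 + k2)%N, (a * c1 * pi ^+ k2 + c2 * pi ^+ k1).
  rewrite [a *: u]/(a * (u : R)) mulrDl exprD.
  rewrite [X in X + _](_ : _ = a * ((u : R) * pi ^+ k1) * pi ^+ k2);
    last by rewrite !mulrA.
  rewrite [X in _ + X](_ : _ = ((v : R) * pi ^+ k2) * pi ^+ k1);
    last by rewrite mulrCA mulrC.
  rewrite e1 e2 mulrDl; congr (_ + _); last by rewrite mulrAC.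
  by rewrite !mulrA mulrAC.
have [g Ig] := dvr_principal I subI.
have [k [c gk]] : exists (k : nat) (c : R), g * pi ^+ k = c * r.
  have /asboolP : g \in I by apply/Ig; exists 1; rewrite mul1r.
  by [].
have g0 : g != 0.
  apply/eqP => g0; have [d /eqP] : rdvd g r.
    by apply/Ig/asboolP; exists 0%N, 1; rewrite mulr1 mul1r.
  by rewrite g0 mulr0 (negPf r0).
have gu : g \is a GRing.unit.
  apply/negbNE/negP => /nonunit_uniformizer[h gh].
  have [d hd] : rdvd g h.
    by apply/Ig/asboolP; exists k.+1, c; rewrite exprS mulrA -gh.
  have e1 : d * pi = 1 by apply: (mulIf g0); rewrite mul1r mulrAC -hd -gh.
  have := uniformizer_nonunit; rewrite (_ : pi \is a GRing.unit) //.
  by apply/unitrPr; exists d; rewrite mulrC.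
clear Ig; clear subI; clear I; elim: k c r {r0} gk => [|k IH] c r gk.
  have : c * r \is a GRing.unit by rewrite -gk expr0 mulr1.
  rewrite unitrM => /andP[_ ru].
  by exists r => //; exists 0%N; rewrite mulr1.
case: (boolP (r \is a GRing.unit)) => [ru|].
  by exists r => //; exists 0%N; rewrite mulr1.
move/nonunit_uniformizer => [s rs].
have [|e eu [j sj]] := IH c s.
  by apply: (mulIf (uniformizer_neq0 (s := R))); rewrite -!mulrA -exprSr gk rs.
by exists e => //; exists j.+1; rewrite rs sj -mulrA -exprSr.
Qed.

Definition is_valuation x (m : int) : Prop :=
  exists2 e : R, e \is a GRing.unit & x = e%:F * pi%:F ^ m.

Lemma unit_tofrac_neq0 (e : R) : e \is a GRing.unit -> e%:F != 0 :> K.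
Proof. by move=> eu; rewrite tofrac_eq0; apply: contraTneq eu => ->; rewrite unitr0. Qed.

Lemma fractionP x : exists a b : R, b != 0 /\ x = a%:F / b%:F.
Proof.
move: x; apply: quotW => -[[a b] /= b0]; exists a, b; split => //.
apply/(canRL (mulfK _)); first by rewrite tofrac_eq0.
unlock FracField.tofrac; rewrite -[LHS]FracField.pi_mul /FracField.mulf.
apply/eqP; rewrite FracField.equivf_def /=.
by rewrite !numden_Ratio ?mulf_neq0 ?oner_neq0 //= !mulr1 mulrC.
Qed.

Lemma is_valuation_ex x : x != 0 -> exists m, is_valuation x m.
Proof.
have [a [b [b0 ->]]] := fractionP x.
rewrite mulf_eq0 invr_eq0 !tofrac_eq0 (negPf b0) orbF => a0.
have [e eu [j ->]] := dvr_factor a0.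
have [f fu [k ->]] := dvr_factor b0.
exists (j%:Z - k%:Z), (e / f); first by rewrite unitrM eu unitrV.
have Fu : f%:F * (f^-1)%:F = 1 :> K by rewrite -tofracM divrr.
rewrite !tofracM !tofracXn invfM expfzDr ?uniformizerF_neq0 //.
rewrite -exprnP exprnN mulrACA; congr (_ * _).
have f0 := unit_tofrac_neq0 fu.
by congr (_ * _); apply: (mulfI f0); rewrite Fu divff.
Qed.

Lemma is_valuation_uniq x m n : is_valuation x m -> is_valuation x n -> m = n.
Proof.
move=> [e eu xe] [f fu xf].
wlog: m n e f eu fu xe xf / (m <= n)%R.
  by case: (leP m n) => [mn|/ltW nm] H; [apply: (H m n e f)|
    apply/esym/(H n m f e)].
rewrite le_eqVlt => /predU1P[//|mn].
have : pi%:F ^ (n - m) = (e / f)%:F :> K.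
  have f0 := unit_tofrac_neq0 fu.
  apply: (mulIf (uniformizerFX_neq0 m)).
  rewrite -expfzDr ?uniformizerF_neq0 // subrK.
  apply: (mulfI f0); rewrite -xf xe tofracM mulrA; congr (_ * _).
  by rewrite mulrCA -tofracM divrr // tofrac1 mulr1.
case E : (n - m) => [[|k]|k].
- by move/eqP: E; rewrite subr_eq0 => /eqP ->.
- rewrite -exprnP -tofracXn => /eqP; rewrite tofrac_eq => /eqP ek.
  have : e / f \is a GRing.unit by rewrite unitrM eu unitrV.
  by rewrite -ek exprS unitrM (negPf uniformizer_nonunit).
- by move: mn; rewrite -subr_gt0 E.
Qed.

Definition vK x : \bar int :=
  if x == 0 then +oo%E else (xget 0 (is_valuation x))%:E.

Lemma vKP x m : is_valuation x m -> vK x = m%:E.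
Proof.
move=> xm; rewrite /vK; case: eqP => [x0|_].
  case: xm => e eu; rewrite x0 => /esym/eqP.
  by rewrite mulf_eq0 (negPf (unit_tofrac_neq0 eu)) (negPf (uniformizerFX_neq0 m)).
by congr EFin; case: xgetP => [n _ xn|/(_ m)//]; apply: is_valuation_uniq xn xm.
Qed.

Lemma vK_geP x (q : rat) :
  (0 <= er_map (intr : int -> rat) (vK x) + q%:E)%E <->
  exists (r : R) (m : int), x = r%:F * pi%:F ^ m /\ 0 <= m%:~R + q.
Proof.
split; last first.
  move=> [r [m [-> mq]]]; have [->|r0] := eqVneq r 0.
    by rewrite tofrac0 mul0r /vK eqxx.
  have [e eu [k ->]] := dvr_factor r0.
  rewrite (@vKP _ (k%:Z + m)) /=; last first.
    exists e => //; rewrite tofracM tofracXn expfzDr ?uniformizerF_neq0 //.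
    by rewrite -exprnP mulrA.
  rewrite -EFinD lee_fin rmorphD /= -addrA addr_ge0 //.
have [->|x0] := eqVneq x 0.
  move=> _; exists 0, (Num.bound `|q|)%:Z; rewrite tofrac0 mul0r; split => //.
  rewrite -pmulrn -[X in _ + X]opprK subr_ge0 (le_trans (ler_norm _)) //.
  by rewrite normrN ltW // archi_boundP.
have [m xm] := is_valuation_ex x0.
rewrite (vKP xm) /= -EFinD lee_fin => mq.
by case: xm => e _ ->; exists e, m.
Qed.
End Valuation.

Definition powser (A : Type) := nat -> A.

Section PowerSeriesRing.
Variable A : comNzRingType.
Implicit Types f g h : powser A.

HB.instance Definition _ := gen_eqMixin (powser A).
HB.instance Definition _ := gen_choiceMixin (powser A).

Definition powser_zero : powser A := fun=> 0.
Definition powser_opp f : powser A := fun i => - f i.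
Definition powser_add f g : powser A := fun i => f i + g i.
Definition powser_one : powser A := fun i => (i == 0%N)%:R.
Definition powser_mul f g : powser A :=
  fun i => \sum_(j < i.+1) f j * g (i - j)%N.

Fact powser_addA : associative powser_add.
Proof. by move=> f g h; apply/funext => i; rewrite /powser_add addrA. Qed.
Fact powser_addC : commutative powser_add.
Proof. by move=> f g; apply/funext => i; rewrite /powser_add addrC. Qed.
Fact powser_add0 : left_id powser_zero powser_add.
Proof. by move=> f; apply/funext => i; rewrite /powser_add add0r. Qed.
Fact powser_addN : left_inverse powser_zero powser_opp powser_add.
Proof. by move=> f; apply/funext => i; rewrite /powser_add addNr. Qed.

HB.instance Definition _ := GRing.isZmodule.Build (powser A)
  powser_addA powser_addC powser_add0 powser_addN.

Fact powser_mulC : commutative powser_mul.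
Proof.
move=> f g; apply/funext => i; rewrite /powser_mul (reindex_inj rev_ord_inj) /=.
by apply: eq_bigr => j _; rewrite (sub_ordK j) mulrC.
Qed.

Fact powser_mulA : associative powser_mul.
Proof.
move=> f g h; rewrite [RHS]powser_mulC [powser_mul g h]powser_mulC.
apply/funext => i; rewrite /powser_mul.
pose coef3 j k := f j * (h k * g (i - j - k)%N).
transitivity (\sum_(j < i.+1) \sum_(k < i.+1 | (k <= i - j)%N) coef3 j k).
  apply: eq_bigr => /= j _; rewrite big_distrr /=.
  by rewrite (big_ord_narrow_leq (leq_subr _ _)).
rewrite (exchange_big_dep predT) //=; apply: eq_bigr => k _.
transitivity (\sum_(j < i.+1 | (j <= i - k)%N) coef3 j k).
  apply: eq_bigl => j; rewrite -ltnS -(ltnS j) -!subSn ?leq_ord //.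
  by rewrite -subn_gt0 -(subn_gt0 j) -!subnDA addnC.
rewrite (big_ord_narrow_leq (leq_subr _ _)) big_distrr /=.
by apply: eq_bigr => j _; rewrite /coef3 -!subnDA addnC mulrCA.
Qed.

Fact powser_mul1 : left_id powser_one powser_mul.
Proof.
move=> f; apply/funext => i; rewrite /powser_mul /powser_one big_ord_recl subn0.
by rewrite mul1r big1 ?addr0 // => j _; rewrite mul0r.
Qed.

Fact powser_mulDl : left_distributive powser_mul powser_add.
Proof.
move=> f g h; apply/funext => i; rewrite /powser_mul /powser_add -big_split.
by apply: eq_bigr => j _; rewrite mulrDl.
Qed.

Fact powser_1neq0 : powser_one != powser_zero.
Proof.
apply/eqP => /(congr1 (fun f => f 0%N)) /eqP.
by rewrite /powser_one /powser_zero oner_eq0.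
Qed.

HB.instance Definition _ := GRing.Zmodule_isComNzRing.Build (powser A)
  powser_mulA powser_mulC powser_mul1 powser_mulDl powser_1neq0.
End PowerSeriesRing.

Section Snu.
Variables (R : completeDvrType) (nu : rat).
Local Notation pi := (@uniformizer R).

Definition in_Snu : {pred powser {fraction R}} := [pred a |
  `[< forall i, (0 <= er_map (intr : int -> rat) (vK (a i))
                      + (nu * i%:R)%:E)%E >]].

Lemma in_SnuP a : reflect (forall i, exists (r : R) (m : int),
  a i = r%:F * pi%:F ^ m /\ 0 <= m%:~R + nu * i%:R) (a \in in_Snu).
Proof.
apply: (iffP idP) => [/asboolP aS i|aS]; first exact/vK_geP.
by apply/asboolP => i; apply/vK_geP.
Qed.

Lemma in_Snu_add (r s : R) (m n : int) (q : rat) :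
  0 <= m%:~R + q -> 0 <= n%:~R + q ->
  exists (t : R) (k : int),
    r%:F * pi%:F ^ m + s%:F * pi%:F ^ n = t%:F * pi%:F ^ k /\ 0 <= k%:~R + q.
Proof.
wlog: r s m n / (m <= n)%R => [H mq nq|].
  case: (leP m n) => [mn|/ltW nm]; first exact: H.
  by rewrite addrC; apply: H.
move=> mn mq nq; exists (r + s * pi ^+ `|n - m|), m; split => //.
rewrite tofracD tofracM tofracXn exprnP gez0_abs ?subr_ge0 // mulrDl.
by rewrite -mulrA -expfzDr ?uniformizerF_neq0 // subrK.
Qed.

Fact in_Snu_subring_closed : subring_closed in_Snu.
Proof.
split.
- apply/in_SnuP => -[|i].
    by exists 1, 0; rewrite tofrac1 expr0z mulr1 mulr0 addr0.
  by apply/vK_geP; rewrite [X in vK X](_ : _ = 0) // /vK eqxx.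
- move=> a b /in_SnuP aS /in_SnuP bS; apply/in_SnuP => i.
  have [r [m [ai mi]]] := aS i; have [s [n [bi ni]]] := bS i.
  have [t [k [e ki]]] := @in_Snu_add r (- s) m n _ mi ni.
  exists t, k; split => //; rewrite -e tofracN mulNr -ai -bi //.
- move=> a b /in_SnuP aS /in_SnuP bS; apply/in_SnuP => i.
  pose P z := exists (r : R) (m : int),
    z = r%:F * pi%:F ^ m /\ 0 <= m%:~R + nu * i%:R.
  apply: (big_ind P).
  + by apply/vK_geP; rewrite /vK eqxx.
  + by move=> _ _ [r [m [-> mi]]] [s [n [-> ni]]]; apply: in_Snu_add.
  + move=> j _; have [r [m [-> mi]]] := aS j.
    have [s [n [-> ni]]] := bS (i - j)%N.
    exists (r * s), (m + n); split.
      by rewrite tofracM expfzDr ?uniformizerF_neq0 // mulrACA.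
    have -> : nu * i%:R = nu * j%:R + nu * (i - j)%:R :> rat.
      by rewrite -mulrDr -natrD subnKC ?leq_ord.
    by rewrite rmorphD /= addrACA addr_ge0.
Qed.

HB.instance Definition _ := GRing.isSubringClosed.Build
  (powser {fraction R}) in_Snu in_Snu_subring_closed.

Record Snu := SnuOf { Snu_series : powser {fraction R}; _ : Snu_series \in in_Snu }.

HB.instance Definition _ := [isSub for Snu_series].
HB.instance Definition _ := [Choice of Snu by <:].
HB.instance Definition _ := [SubChoice_isSubComNzRing of Snu by <:].
End Snu.

Section Modules.
Variable A : comNzRingType.

Definition generated_by (V : lmodType A) (k : nat) : Prop :=
  exists e : 'I_k -> V, forall x, exists c : 'I_k -> A, x = \sum_i c i *: e i.

Definition finitely_generated (V : lmodType A) : Prop :=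
  exists k, generated_by V k.

Definition torsion_free (V : lmodType A) : Prop :=
  forall (s : A) (x : V), s *: x = 0 -> s = 0 \/ x = 0.

(* The quotient Q / P of submodules P <= Q of V has finite length: the strict
   chains of its submodules, that is, of submodules of V between P and Q,
   have bounded length. *)
Definition quotient_finite_length (V : lmodType A) (P Q : {pred V}) : Prop :=
  exists l : nat, forall (n : nat) (C : nat -> {pred V}),
    (forall i, (i <= n)%N ->
       [/\ GRing.submod_closed (C i), {subset P <= C i} & {subset C i <= Q}]) ->
    (forall i, (i < n)%N ->
       {subset C i <= C i.+1} /\ ~ {subset C i.+1 <= C i}) ->
    (n <= l)%N.

Definition lin_ker (V W : lmodType A) (f : {linear V -> W}) : {pred V} :=
  [pred x | f x == 0].

Definition lin_im (V W : lmodType A) (f : {linear V -> W}) : {pred W} :=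
  [pred y | `[< exists x, y = f x >]].

Definition quasi_isomorphism (V W : lmodType A) (f : {linear V -> W}) : Prop :=
  quotient_finite_length (pred1 0) (lin_ker f) /\
  quotient_finite_length (lin_im f) predT.

(* Max (V) is the pair (W, f), unique up to isomorphism. *)
Definition is_Max (V W : lmodType A) (f : {linear V -> W}) : Prop :=
  [/\ finitely_generated W, torsion_free W, quasi_isomorphism f &
    forall (N : lmodType A) (f' : {linear V -> N}),
      finitely_generated N -> torsion_free N -> quasi_isomorphism f' ->
      exists g : {linear N -> W}, g \o f' =1 f].

Record submodule (V : lmodType A) (M : submodClosed V) :=
  SubmoduleOf { submodule_val : V; _ : submodule_val \in M }.

Section SubmoduleLmod.
Variables (V : lmodType A) (M : submodClosed V).
HB.instance Definition _ := [isSub for @submodule_val V M].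
HB.instance Definition _ := [Choice of submodule M by <:].
HB.instance Definition _ := [SubChoice_isSubLmodule of submodule M by <:].
End SubmoduleLmod.

End Modules.

(* [a 0; a 1, ..., a n] *)
Fixpoint cfrac (a : nat -> int) (n : nat) : rat :=
  if n is n'.+1 then (a 0%N)%:~R + (cfrac (fun i => a i.+1) n')^-1
  else (a 0%N)%:~R.

(* Main.v *)
(* Write [nu = be / al] in lowest terms. After adjoining [pi^(1/al)], with
   [u' = u / pi^nu], the ring [S_nu] becomes the degree-zero part of a regular
   local ring [S'] of dimension two graded by [Z/al]. As [Max(M)] is reflexive, it
   is the degree-zero part of a graded reflexive, hence free, [S']-module, so it
   is a direct sum of at most [d] modules [{f | v_nu(f) >= c}]. The homogeneous
   components of that [S']-module can be described without leaving [K[[u]]^d],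
   namely as [N_j = {y | s y in Max(M) for all s with al v_nu(s) >= -j}];
   reflexivity makes [u] regular modulo [pi^(1/al)], and lifting a basis modulo
   [(pi^(1/al), u')] gives elements that are independent (hence at most [d]) and
   that generate by Nakayama's lemma.
   Each module [{f | v_nu(f) >= c}] is generated by monomials, and the number of
   monomials needed depends on [nu] only: if [r(theta)] is the number of lattice
   points needed to dominate the points below a line of slope [theta], then
   [r(theta + 1) = r(theta)], [r(0) = 1] and [r(theta) <= 1 + r(-1/theta)] for
   [theta > 0]. Running through the continued fraction, only the partial
   quotients of even index cost more than a shift. *)
From HB Require Import structures.
Require Import Defs.
From mathcomp Require Import all_boot all_order all_algebra.
From mathcomp Require Import fraction boolp zify ring lra.

Set Implicit Arguments.
Unset Strict Implicit.
Unset Printing Implicit Defensive.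

Import Order.TTheory GRing.Theory Num.Theory.
Local Open Scope ring_scope.

(** * Lattice points above a line *)

(** A point [(i, m)] stands for the monomial [pi^(-m) u^i]. For [theta = nu], lying below the line
    means having Gauss valuation at least [- x]. *)
Definition below_line (theta x : rat) (p : nat * int) : bool :=
  p.2%:~R <= x + theta * p.1%:R.

(** For [theta = nu], this is divisibility in [S_nu] of the monomial of [q] by that of [p]. *)
Definition dominates (theta : rat) (p q : nat * int) : bool :=
  (p.1 <= q.1)%N && (q.2%:~R - p.2%:~R <= theta * (q.1%:R - p.1%:R)).

(** The count is uniform in the intercept: the thresholds of the modules to be generated are not
    known in advance, and exchanging the coordinates changes the intercept. *)
Definition line_gens (theta : rat) (k : nat) : Prop :=
  forall x : rat, exists s : seq (nat * int),
    [/\ (size s <= k)%N, all (below_line theta x) s &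
      forall q, below_line theta x q -> exists2 p, p \in s & dominates theta p q].

Lemma line_gens_le theta k l : (k <= l)%N -> line_gens theta k -> line_gens theta l.
Proof.
move=> kl H x; have [s [sk s1 s2]] := H x.
by exists s; split=> //; apply: leq_trans kl.
Qed.

Lemma line_gens0 : line_gens 0 1.
Proof.
move=> x; exists [:: (0%N, Num.floor x)]; split => //=.
  by rewrite /below_line /= mul0r addr0 floor_le.
move=> [i m]; rewrite /below_line /= mul0r addr0 => mx.
exists (0%N, Num.floor x); rewrite ?mem_head // /dominates /= mul0r subr_le0 ler_int.
by rewrite floor_ge_int.
Qed.

(** The shear [(i, m) -> (i, m + c i)] respects both relations. *)
Lemma line_gens_shift theta k (c : int) :
  line_gens theta k -> line_gens (theta + c%:~R) k.
Proof.
move=> H x; have [s [sk /allP s1 s2]] := H x.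
exists [seq (p.1, p.2 + c * p.1%:Z) | p <- s]; split.
- by rewrite size_map.
- apply/allP => _ /mapP[p ps ->]; have := s1 p ps.
  by rewrite /below_line /= rmorphD rmorphM /= -pmulrn; lra.
move=> [i m] im; have [|p ps] := s2 (i, m - c * i%:Z).
  by move: im; rewrite /below_line /= rmorphB rmorphM /= -pmulrn; lra.
rewrite /dominates /= => /andP[pi pm].
exists (p.1, p.2 + c * p.1%:Z); first by apply/mapP; exists p.
rewrite /dominates /= pi /=; move: pm.
by rewrite rmorphB rmorphD !rmorphM /= -!pmulrn; lra.
Qed.

(* Points of height at most [floor x] are dominated by [(0, floor x)]. Seen from
   the height [floor x + 1], the others form, with the coordinates exchanged, the
   points on one side of a line of slope [1 / theta]. *)
Lemma line_gens_inv theta k : 0 < theta ->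
  line_gens (- theta^-1) k -> line_gens theta k.+1.
Proof.
move=> t0 H x; have t1 : theta * theta^-1 = 1 by rewrite mulfV // gt_eqF.
have ti0 : 0 < theta^-1 by rewrite invr_gt0.
have [M ME] : exists M, M = Num.floor x + 1 by exists (Num.floor x + 1).
have xM : x < M%:~R by rewrite ME floorD1_gt.
have Mx : M%:~R <= x + 1 by rewrite ME rmorphD lerD2r floor_le.
have [s [sk /allP s1 s2]] := H (theta^-1 * (x - M%:~R)).
pose g (p : nat * int) := (`|p.2|%N, p.1%:Z + M).
(* As [x < M], the exchanged line has negative intercept and negative slope, so its points have
   [p.2 <= 0] and the absolute value in [g] is only a change of sign. *)
have s0 p : p \in s -> [/\ p.2 <= 0 & p.1%:R + (M%:~R - x) <= theta * (`|p.2|)%:R].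
  move=> ps; have := s1 p ps; rewrite /below_line /= => pb.
  have p2 : p.2%:~R <= 0 :> rat.
    apply: (le_trans pb); rewrite mulNr -mulrBr pmulr_rle0 //.
    by have := ler0n rat p.1; lra.
  have p2' : p.2 <= 0 by rewrite -(ler_int rat).
  split=> //.
  have -> : (`|p.2|)%:R = - p.2%:~R :> rat.
    by rewrite pmulrn abszE ler0_norm // rmorphN.
  have -> : p.1%:R + (M%:~R - x)
    = theta * (theta^-1 * (p.1%:R + (M%:~R - x))) by rewrite mulrA t1 mul1r.
  by rewrite ler_pM2l //; lra.
exists ((0%N, Num.floor x) :: map g s); split.
- by rewrite /= size_map ltnS.
- rewrite /= {1}/below_line /= mulr0 addr0 floor_le /=.
  apply/allP => _ /mapP[p ps ->]; have [p2 pb] := s0 p ps.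
  by rewrite /below_line /g /= rmorphD /= -pmulrn; lra.
move=> [i m]; rewrite /below_line /= => im.
have [mM|Mm] := ltP m M.
  exists (0%N, Num.floor x); rewrite ?mem_head // /dominates /= subr0.
  apply: (@le_trans _ _ 0); last by rewrite mulr_ge0 // ltW.
  by rewrite subr_le0 ler_int -ltzD1 -ME.
have [j mE] : exists j : nat, m = j%:Z + M.
  by exists `|(m - M)|%N; rewrite gez0_abs ?subr_ge0 // subrK.
have [|p ps] := s2 (j, - i%:Z).
  rewrite /below_line /= rmorphN /= -pmulrn.
  have -> : i%:R = theta^-1 * (theta * i%:R) :> rat.
    by rewrite mulrA [theta^-1 * _]mulrC t1 mul1r.
  rewrite -mulrN mulNr -mulrN -mulrDr ler_pM2l //.
  by move: im; rewrite mE rmorphD /= -pmulrn; lra.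
rewrite /dominates /= => /andP[pj pm].
exists (g p); first by rewrite inE; apply/orP; right; apply/mapP; exists p.
have [p2 pb] := s0 p ps.
have absE : (`|p.2|)%:R = - p.2%:~R :> rat.
  by rewrite pmulrn abszE ler0_norm // rmorphN.
have pjr : p.1%:R <= j%:R :> rat by rewrite ler_nat.
have key : theta^-1 * (j%:R - p.1%:R) <= i%:R - (`|p.2|)%:R.
  by move: pm; rewrite rmorphN /= -pmulrn absE; lra.
rewrite /dominates /g /=; apply/andP; split.
  rewrite -(ler_nat rat) -subr_ge0; apply: le_trans key.
  by rewrite mulr_ge0 ?subr_ge0 // ltW.
rewrite mE !rmorphD /= -!pmulrn.
have -> : j%:R + M%:~R - (p.1%:R + M%:~R) = theta * (theta^-1 * (j%:R - p.1%:R)) :> rat.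
  by rewrite mulrA t1 mul1r; ring.
by rewrite ler_pM2l.
Qed.

(* [1 - 1 / (1 + z) = 1 / (1 + 1 / z)], so each unit of [k] costs one inversion. *)
Lemma line_gens_invD (chi : rat) (k l : nat) : 0 <= chi ->
  line_gens (- chi^-1) l -> line_gens (- (k%:R + chi)^-1) (k + l).
Proof.
move=> c0 H; elim: k => [|k IH]; first by rewrite add0r.
set z := k%:R + chi in IH.
have z0 : 0 <= z by rewrite addr_ge0.
have -> : k.+1%:R + chi = z + 1 by rewrite -[k.+1]addn1 natrD /z; ring.
(* The inversion below needs the slope [z / (z + 1)] to be positive. For [z = 0] the slope to reach
   is [-1], a shear of slope [0]. *)
have [z00|zn0] := eqVneq z 0.
  rewrite z00 add0r invr1 -[- 1]add0r -[- 1]/((-1)%:~R).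
  by apply: (line_gens_le _ (line_gens_shift (-1) line_gens0)); rewrite addSn.
have zp : 0 < z by rewrite lt_def zn0.
have z1 : z + 1 != 0 by rewrite gt_eqF // ltr_wpDr.
rewrite (_ : - (z + 1)^-1 = z / (z + 1) + (-1)%:~R); last by field.
rewrite addSn; apply: line_gens_shift; apply: line_gens_inv.
  by rewrite divr_gt0 // ltr_wpDr.
rewrite (_ : - (z / (z + 1))^-1 = - z^-1 + (-1)%:~R); first exact: line_gens_shift.
by field; apply/andP.
Qed.

Lemma cfrac_gt0 (a : nat -> int) n : (forall i, (i <= n)%N -> 0 < a i) ->
  0 < cfrac a n.
Proof.
elim: n a => [|n IH] a ha /=; first by rewrite ltr0z ha.
rewrite addr_gt0 ?ltr0z ?ha // invr_gt0 IH // => i iN; exact: ha.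
Qed.

(** Write [[a0; a1, ...] = a0 + 1 / (a1 + 1 / t)] with [t = [a2; a3, ...]]. A shift and [a1]
    inversions reduce the slope to [- t], so only quotients of odd index are paid for. *)
Lemma line_gens_oppcfrac (a : nat -> int) n :
  (forall i, (1 <= i <= n)%N -> 0 < a i) ->
  exists2 k : nat, k%:Z <= 1 + \sum_(0 <= i < uphalf n) a (2 * i).+1 &
    line_gens (- cfrac a n) k.
Proof.
have [m] := ubnP n; elim: m n a => // m IH [|[|n]] a mn ha.
- exists 1%N; first by rewrite big_nil.
  by have := line_gens_shift (- a 0%N) line_gens0; rewrite add0r rmorphN.
- have a1 : (`|a 1%N|)%N%:Z = a 1%N by rewrite gez0_abs // ltW // ha.
  exists (`|a 1%N| + 1)%N.
    by rewrite /= big_nat1 muln0 PoszD a1 addrC.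
  rewrite /= opprD addrC -rmorphN; apply: line_gens_shift.
  (* The convention [0^-1 = 0] turns the hypothesis for [chi = 0] into [line_gens 0 1]. *)
  have := @line_gens_invD 0 `|a 1%N| 1 (lexx _).
  rewrite invr0 oppr0 addr0 [X in - X^-1]pmulrn a1.
  by apply; apply: line_gens0.
have [|i i_n|k kb kg] := IH n (fun i => a i.+2); first by move: mn; lia.
  by apply: ha; move: i_n; lia.
have a1 : (`|a 1%N|)%N%:Z = a 1%N by rewrite gez0_abs // ltW // ha.
exists (`|a 1%N| + k)%N.
  rewrite /= big_nat_recl // muln0 PoszD a1 addrCA lerD2l.
  apply: (le_trans kb); rewrite lerD2l le_eqVlt; apply/orP; left; apply/eqP.
  by apply: eq_bigr => i _; rewrite mulnS.
have c0 : 0 < cfrac (fun i => a i.+2) n by apply: cfrac_gt0 => i i_n; apply: ha; lia.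
rewrite [cfrac a _]/= opprD addrC -rmorphN; apply: line_gens_shift.
rewrite -a1 -pmulrn.
by apply: line_gens_invD; rewrite ?invr_ge0 ?(ltW c0) // invrK.
Qed.

(** After a shift by [a 0], one inversion passes from [1 / t] to [- t] with [t = [a1; a2, ...]],
    whose quotients of odd index are those of even index in [a]. This inversion accounts for the
    second unit in the constant [2]. *)
Lemma line_gens_cfrac (a : nat -> int) n :
  (forall i, (1 <= i <= n)%N -> 0 < a i) ->
  exists2 k : nat, k%:Z <= 2 + \sum_(1 <= i < n./2.+1) a (2 * i)%N &
    line_gens (cfrac a n) k.
Proof.
case: n => [|n] ha.
  exists 1%N; first by rewrite big_geq.
  by have := line_gens_shift (a 0%N) line_gens0; rewrite add0r.
have [i i_n|k kb kg] := @line_gens_oppcfrac (fun i => a i.+1) n.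
  by apply: ha; move: i_n; lia.
exists k.+1.
  rewrite -addn1 PoszD addrC -[X in _ <= X + _]/(1 + 1) -addrA lerD2l.
  apply: (le_trans kb); rewrite lerD2l big_add1 /= le_eqVlt; apply/orP; left; apply/eqP.
  by apply: eq_bigr => i _; rewrite mulnS.
rewrite [cfrac a _]/= addrC; apply: line_gens_shift.
have c0 : 0 < cfrac (fun i => a i.+1) n by apply: cfrac_gt0 => i i_n; apply: ha; lia.
by apply: line_gens_inv; rewrite ?invr_gt0 // invrK.
Qed.

(** * Power series *)

Section PowerSeries.
Variable A : comNzRingType.
Implicit Types (x y : A) (s : powser A).

Definition cst x : powser A := fun i => if i == 0%N then x else 0.
Definition var : powser A := fun i => (i == 1%N)%:R.
Definition shift s : powser A := fun i => s i.+1.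

Lemma powserDE s t i : (s + t) i = s i + t i. Proof. by []. Qed.
Lemma powserNE s i : (- s) i = - s i. Proof. by []. Qed.
Lemma powser0E i : (0 : powser A) i = 0. Proof. by []. Qed.
Lemma powserME s t i : (s * t) i = \sum_(j < i.+1) s j * t (i - j)%N.
Proof. by []. Qed.

Lemma powser_sumE (I : Type) (r : seq I) (P : pred I) (F : I -> powser A) i :
  (\sum_(k <- r | P k) F k) i = \sum_(k <- r | P k) F k i.
Proof. by elim/big_rec2: _ => // k _ s _ <-. Qed.

Lemma powserM0 s t : (s * t) 0%N = s 0%N * t 0%N.
Proof. by rewrite powserME big_ord1. Qed.

Lemma cstE x i : cst x i = if i == 0%N then x else 0. Proof. by []. Qed.

Lemma cstME x s i : (cst x * s) i = x * s i.
Proof.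
rewrite powserME big_ord_recl subn0 big1 ?addr0 // => j _.
by rewrite /cst /= mul0r.
Qed.

Lemma cst1 : cst 1 = 1.
Proof. by apply/funext => i; rewrite /cst; case: i. Qed.

Lemma cstM x y : cst (x * y) = cst x * cst y.
Proof. by apply/funext => -[|i]; rewrite cstME /cst //= mulr0. Qed.

Lemma varM0 s : (var * s) 0%N = 0.
Proof. by rewrite powserM0 /var mul0r. Qed.

Lemma varMS s i : (var * s) i.+1 = s i.
Proof.
rewrite powserME !big_ord_recl big1 ?addr0 => [|j _]; last by rewrite /var /= mul0r.
by rewrite /var /= mul0r add0r mul1r subSS subn0.
Qed.

Lemma varXME n s i : (var ^+ n * s) i = if (i < n)%N then 0 else s (i - n)%N.
Proof.
elim: n i => [|n IH] i; first by rewrite mul1r subn0.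
by rewrite exprS -mulrA; case: i => [|i]; rewrite ?varM0 // varMS IH.
Qed.

Lemma powser_decomp s : s = cst (s 0%N) + var * shift s.
Proof.
apply/funext => -[|i]; rewrite powserDE ?varM0 ?varMS ?addr0 //.
by rewrite /cst /= add0r.
Qed.
End PowerSeries.

(** The lowest nonzero coefficients of two nonzero series multiply to a nonzero coefficient of the
    product. *)
Lemma powser_eq0 (F : fieldType) (s t : powser F) : s * t = 0 -> s = 0 \/ t = 0.
Proof.
move=> st0; have [|/eqP s0] := pselect (s = 0); [by left|right; apply/eqP].
have [i si] : exists i, s i != 0.
  apply: contrapT => H; move/eqP: s0; apply; apply/funext => i; apply/eqP.
  by apply: contrapT => /negP si; apply: H; exists i.
apply: contrapT => /negP t0.
have [j tj] : exists j, t j != 0.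
  apply: contrapT => H; move/eqP: t0; apply; apply/funext => j; apply/eqP.
  by apply: contrapT => /negP tj; apply: H; exists j.
have [m /= sm mmin] := ex_minnP (ex_intro (fun i => s i != 0) i si).
have [n /= tn nmin] := ex_minnP (ex_intro (fun j => t j != 0) j tj).
have := congr1 (fun f => f (m + n)%N) st0; rewrite powserME /= => /eqP.
have mn : (m < (m + n).+1)%N by rewrite ltnS leq_addr.
rewrite (bigD1 (Ordinal mn)) //= addKn big1 => [|k km].
  by rewrite addr0 powser0E mulf_eq0 (negPf sm) (negPf tn).
have [kltm|] := ltnP k m.
  by case: eqP (mmin k) => [->|_ /(_ isT)]; rewrite ?mul0r // leqNgt kltm.
rewrite leq_eqVlt => /predU1P[mk|mk].
  by case/eqP: km; apply: val_inj.
have kn : (m + n - k < n)%N by have := ltn_ord k; lia.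
by case: eqP (nmin (m + n - k)%N) => [->|_ /(_ isT)]; rewrite ?mulr0 // leqNgt kn.
Qed.

(** * Valuations *)

Section Orders.
Variables (R : completeDvrType) (nu : rat).
Local Notation K := {fraction R}.
Local Notation pi := (@uniformizer R).
Local Notation al := (denq nu).
Local Notation be := (numq nu).
Implicit Types (x y : K) (s t : powser K) (j k n : int).

(* With [nu = be / al], valuations are multiplied by [al] so that the Gauss
   valuation [min (v (a_i) + nu i)] becomes integral. *)
Definition kge x n : Prop :=
  exists (r : R) (m : int), x = r%:F * pi%:F ^ m /\ n <= al * m.

(** A lower bound on the scaled Gauss valuation. It makes sense on all of [K[[u]]], with [j] of any
    sign, and [sge 0] cuts out [S_nu]. *)
Definition sge j s : Prop := forall i : nat, kge (s i) (j - be * i%:Z).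

Lemma kge_le x n n' : n' <= n -> kge x n -> kge x n'.
Proof. by move=> nn [r [m [-> nm]]]; exists r, m; split=> //; apply: le_trans nm. Qed.

Lemma al_gt0 : 0 < al. Proof. exact: denq_gt0. Qed.

Lemma kge0 n : kge 0 n.
Proof.
exists 0, `|n|; rewrite tofrac0 mul0r; split => //.
apply: (le_trans (ler_norm n)); rewrite -{1}[`|n|]mul1r ler_wpM2r //.
by rewrite -gtz0_ge1 al_gt0.
Qed.

Lemma kgeD x y n : kge x n -> kge y n -> kge (x + y) n.
Proof.
move=> [r [m [-> mn]]] [r' [m' [-> mn']]].
wlog mm : r r' m m' mn mn' / m <= m' => [H|].
  by case: (leP m m') => [|/ltW] mm; [|rewrite addrC]; apply: H.
exists (r + r' * pi ^+ `|m' - m|), m; split=> //.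
rewrite tofracD tofracM tofracXn exprnP gez0_abs ?subr_ge0 // mulrDl.
by rewrite -mulrA -expfzDr ?uniformizerF_neq0 // subrK.
Qed.

Lemma kgeM x y n n' : kge x n -> kge y n' -> kge (x * y) (n + n').
Proof.
move=> [r [m [-> mn]]] [r' [m' [-> mn']]]; exists (r * r'), (m + m').
rewrite tofracM expfzDr ?uniformizerF_neq0 // mulrACA; split=> //.
by rewrite mulrDr lerD.
Qed.

Lemma kge_tofrac (r : R) : kge r%:F 0.
Proof. by exists r, 0; rewrite expr0z mulr1 mulr0. Qed.

Lemma kge_pi (m : int) : kge (pi%:F ^ m) (al * m).
Proof. by exists 1, m; rewrite tofrac1 mul1r. Qed.

Lemma kgeN x n : kge x n -> kge (- x) n.
Proof.
move=> xn; rewrite -mulN1r -[n]add0r; apply: kgeM => //.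
by rewrite -tofrac1 -tofracN; apply: kge_tofrac.
Qed.

Lemma kge_sum (I : Type) (r : seq I) (P : pred I) (F : I -> K) n :
  (forall i, P i -> kge (F i) n) -> kge (\sum_(i <- r | P i) F i) n.
Proof.
move=> H; elim/big_ind: _ => [|x y|]; [exact: kge0|exact: kgeD|exact: H].
Qed.

(** Modulo larger valuation, a homogeneous coefficient is zero or invertible, as over a field. The
    exchange argument of [fil_basis] rests on this dichotomy. *)
Lemma kge_inv x n : kge x n -> kge x (n + 1) \/ x != 0 /\ kge x^-1 (- n).
Proof.
move=> [r [m [-> mn]]].
have [ru|/nonunit_uniformizer[c ->]] := boolP (r \is a GRing.unit); last first.
  left; exists c, (m + 1); rewrite tofracM expfzDr ?uniformizerF_neq0 // expr1z.
  split; first by ring.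
  by rewrite mulrDr lerD // mulr1 -gtz0_ge1 al_gt0.
move: mn; rewrite le_eqVlt => /predU1P[->|mn]; last first.
  by left; exists r, m; split=> //; rewrite addrC -ltzD1 addrC ltrD2r.
have r0 := unit_tofrac_neq0 ru.
right; split; first by rewrite mulf_neq0 // expfz_neq0 // uniformizerF_neq0.
exists r^-1, (- m); split; last by rewrite mulrN.
rewrite invfM invr_expz; congr (_ * _); apply: (mulfI r0).
by rewrite mulfV // -tofracM mulrV // tofrac1.
Qed.

Lemma kge_eq0 x : (forall n, kge x n) -> x = 0.
Proof.
move=> H; apply/eqP/negP => /negP x0.
have [k xk] := is_valuation_ex x0; case: xk => e eu xe.
have [r [m [xr km]]] := H (al * (k + 1)).
move: km; rewrite ler_pM2l ?al_gt0 // => km.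
have pk := uniformizerFX_neq0 R k.
have : e = r * pi ^+ `|m - k|.
  apply/eqP; rewrite -tofrac_eq tofracM tofracXn exprnP gez0_abs; last by lia.
  apply/eqP/(mulIf pk); rewrite -xe xr -mulrA -expfzDr ?uniformizerF_neq0 //.
  by rewrite subrK.
have -> : `|m - k|%N = `|m - k|.-1.+1 by lia.
rewrite exprSr mulrA => er; have := eu; apply/negP/nonunit_uniformizer.
by eexists; exact: er.
Qed.

Lemma sge_le s j k : k <= j -> sge j s -> sge k s.
Proof. by move=> kj sj i; apply: kge_le (sj i); rewrite lerD2r. Qed.

Lemma sge0 j : sge j 0. Proof. by move=> i; apply: kge0. Qed.

Lemma sgeD s t j : sge j s -> sge j t -> sge j (s + t).
Proof. by move=> sj tj i; apply: kgeD; [apply: sj|apply: tj]. Qed.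

Lemma sgeN s j : sge j s -> sge j (- s).
Proof. by move=> sj i; apply: kgeN; apply: sj. Qed.

Lemma sgeM s t j k : sge j s -> sge k t -> sge (j + k) (s * t).
Proof.
move=> sj tk i; rewrite powserME; apply: kge_sum => l _.
apply: kge_le (kgeM (sj l) (tk (i - l)%N)); rewrite le_eqVlt; apply/orP; left.
by rewrite -subzn ?leq_ord //; apply/eqP; ring.
Qed.

Lemma sge_cst x n : kge x n -> sge n (cst x).
Proof.
by move=> xn [|i]; rewrite cstE /=; [rewrite mulr0 subr0|apply: kge0].
Qed.

Lemma sge_var : sge be (var K).
Proof.
move=> [|[|i]]; rewrite /var /=; try exact: kge0.
by rewrite mulr1 subrr -tofrac1; apply: kge_tofrac.
Qed.

Lemma sge_varX (l : nat) : sge (be * l%:Z) (var K ^+ l).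
Proof.
elim: l => [|l IH]; first by rewrite expr0 mulr0 -cst1 -tofrac1; apply/sge_cst/kge_tofrac.
by rewrite exprS -addn1 PoszD mulrDr mulr1 addrC; apply: sgeM IH; apply: sge_var.
Qed.

Lemma sge_shift s j : sge j s -> sge (j - be) (shift s).
Proof.
move=> sj i; apply: kge_le (sj i.+1); rewrite le_eqVlt; apply/orP; left.
by rewrite -addn1 PoszD; apply/eqP; ring.
Qed.

Lemma in_Snu_sge s : s \in @in_Snu R nu <-> sge 0 s.
Proof.
have H (m : int) (i : nat) :
  (0 <= m%:~R + nu * i%:R) = (0 - be * i%:Z <= al * m).
  rewrite -(ler_int rat) sub0r rmorphN !rmorphM /= -pmulrn -[nu in LHS]divq_num_den.
  have a0 : 0 < al%:~R :> rat by rewrite ltr0z al_gt0.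
  rewrite -(pmulr_rge0 _ a0) -[RHS]subr_ge0; congr (0 <= _).
  by field; rewrite gt_eqF.
by split=> [/in_SnuP sS i|sS]; [|apply/in_SnuP => i]; have [r [m [e mi]]] := sS i;
  exists r, m; split=> //; move: mi; rewrite H.
Qed.
End Orders.

(** * Linear dependence over an integral domain *)

Section LinearDependence.
Variable A : comNzRingType.
Hypothesis domA : forall x y : A, x * y = 0 -> x = 0 \/ y = 0.

(** Fraction-free elimination: a vector with nonzero first entry is the pivot, and
    cross-multiplication removes the first coordinate from the others. *)
Lemma linear_dependence (d r : nat) (v : 'I_r -> 'I_d -> A) : (d < r)%N ->
  exists2 c : 'I_r -> A, exists i, c i <> 0 & forall k, \sum_i c i * v i k = 0.
Proof.
elim: d r v => [|d IH] [|r] // v dr.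
  by exists (fun=> 1) => [|[]//]; exists ord0; apply/eqP/oner_neq0.
have [[i vi]|v0] := pselect (exists i, v i ord0 <> 0); last first.
  have [|c cN c0] := IH _ (fun i k => v i (lift ord0 k)); first exact: ltnW dr.
  exists c => // k; case: (unliftP ord0 k) => [j ->|->]; first exact: c0.
  rewrite big1 // => i _; case: (pselect (v i ord0 = 0)) => [->|vi].
    by rewrite mulr0.
  by case: v0; exists i.
pose w j k := v i ord0 * v (lift i j) (lift ord0 k)
              - v (lift i j) ord0 * v i (lift ord0 k).
have [|c [j0 cj0] c0] := IH r w; first by [].
(* The coefficient of the pivot is the one that cancels the first coordinate. *)
exists (fun l => if unlift i l is Some j then v i ord0 * c j
                 else - \sum_j c j * v (lift i j) ord0) => [|k].
  by exists (lift i j0); rewrite liftK => /domA[].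
rewrite (bigD1_ord i) //= unlift_none; under [X in _ + X]eq_bigr do rewrite liftK.
rewrite mulNr mulr_suml addrC -sumrB.
case: (unliftP ord0 k) => [k' ->|->].
  by rewrite -[RHS](c0 k'); apply: eq_bigr => j _; rewrite /w; ring.
by rewrite big1 // => j _; ring.
Qed.
End LinearDependence.

(** * The ring [S_nu] inside [K[[u]]] *)

Section SnuSeries.
Variables (R : completeDvrType) (nu : rat).
Implicit Types f g : Snu R nu.

Lemma Snu_seriesM f g : Snu_series (f * g) = Snu_series f * Snu_series g.
Proof. exact: (rmorphM (\val : Snu R nu -> powser {fraction R})). Qed.

Lemma Snu_seriesD f g : Snu_series (f + g) = Snu_series f + Snu_series g.
Proof. exact: (rmorphD (\val : Snu R nu -> powser {fraction R})). Qed.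

Lemma Snu_series0 : Snu_series (0 : Snu R nu) = 0.
Proof. exact: (rmorph0 (\val : Snu R nu -> powser {fraction R})). Qed.

Lemma Snu_series1 : Snu_series (1 : Snu R nu) = 1.
Proof. exact: (rmorph1 (\val : Snu R nu -> powser {fraction R})). Qed.

Lemma Snu_series_sum (I : Type) (r : seq I) (P : pred I) (F : I -> Snu R nu) :
  Snu_series (\sum_(i <- r | P i) F i) = \sum_(i <- r | P i) Snu_series (F i).
Proof. exact: (raddf_sum (\val : Snu R nu -> powser {fraction R})). Qed.

Lemma Snu_series_sge f : sge nu 0 (Snu_series f).
Proof. by apply/in_Snu_sge; apply: (valP f). Qed.

Lemma Snu_seriesP s : sge nu 0 s -> exists f, Snu_series f = s.
Proof. by move=> s0; exists (SnuOf (iffRL (in_Snu_sge nu s) s0)). Qed.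

Lemma Snu_series_inj : injective (@Snu_series R nu).
Proof. exact: val_inj. Qed.

Lemma Snu_mul_eq0 f g : f * g = 0 -> f = 0 \/ g = 0.
Proof.
move=> /(congr1 (@Snu_series R nu)); rewrite Snu_seriesM Snu_series0.
by move=> /powser_eq0[] fg; [left|right]; apply: Snu_series_inj; rewrite Snu_series0.
Qed.
End SnuSeries.

(** * Filtered structure of a reflexive module *)

Lemma scaler_rowE (A : comNzRingType) (d : nat) (a : A) (x : 'rV[A]_d) k :
  (a *: x) ord0 k = a * x ord0 k.
Proof. by rewrite mxE. Qed.

Section Reflexive.
Variables (R : completeDvrType) (nu : rat) (d : nat).
Local Notation K := {fraction R}.
Local Notation pi := (@uniformizer R).
Local Notation al := (denq nu).
Local Notation be := (numq nu).
Local Notation L := 'rV[powser K]_d.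
Local Notation kge := (kge nu).
Local Notation sge := (sge nu).
Local Notation u := (var K).

Variable W : L -> Prop.
Hypothesis W0 : W 0.
Hypothesis WD : forall x y, W x -> W y -> W (x + y).
Hypothesis WZ : forall s x, sge 0 s -> W x -> W (s *: x).
Hypothesis W_integral : forall x, W x -> forall k, sge 0 (x ord0 k).
(** The series [f] run over the maximal ideal of [S_nu]: a vector that this whole ideal sends into
    [W] is already in [W]. Reflexivity enters in this form. *)
Hypothesis W_reflexive : forall y,
  (forall f, sge 0 f -> kge (f 0%N) 1 -> W (f *: y)) -> W y.
Implicit Types (x y : L) (s : powser K) (i j n t : int).

Definition fil j y : Prop := forall s, sge (- j) s -> W (s *: y).

(* The degree [j] part of [(pi^(1/al), u) N'], where [N'] is the graded module
   with components [fil j]. *)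
Definition fil_max j y : Prop :=
  exists y1 y2, [/\ fil (j + 1) y1, fil (j - be) y2 & y = y1 + u *: y2].

Lemma fil_le i j y : i <= j -> fil j y -> fil i y.
Proof. by move=> ij yj s si; apply/yj/(sge_le _ si); rewrite lerN2. Qed.

Lemma fil0 j : fil j 0.
Proof. by move=> s _; rewrite scaler0. Qed.

Lemma filD j x y : fil j x -> fil j y -> fil j (x + y).
Proof. by move=> xj yj s sj; rewrite scalerDr; apply: WD; [apply: xj|apply: yj]. Qed.

Lemma filZ i j s y : sge i s -> fil j y -> fil (j + i) (s *: y).
Proof.
move=> si yj t ti; rewrite scalerA; apply: yj.
by rewrite (_ : - j = - (j + i) + i); [apply: sgeM|ring].
Qed.

Lemma filN j y : fil j y -> fil j (- y).
Proof.
move=> yj; rewrite -scaleN1r -[j]addr0; apply: filZ => //.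
by apply: sgeN; rewrite -cst1 -tofrac1; apply/sge_cst/kge_tofrac.
Qed.

Lemma fil_sum (I : Type) (r : seq I) (P : pred I) (F : I -> L) j :
  (forall k, P k -> fil j (F k)) -> fil j (\sum_(i <- r | P i) F i).
Proof.
move=> H; elim/big_ind: _ => [|x y|]; [exact: fil0|exact: filD|exact: H].
Qed.

Lemma sge01 : sge 0 (1 : powser K).
Proof. by rewrite -cst1 -tofrac1; apply/sge_cst/kge_tofrac. Qed.

Lemma fil0P y : fil 0 y <-> W y.
Proof.
split=> [/(_ 1)|Wy s]; rewrite oppr0; last by move=> ?; apply: WZ.
by rewrite scale1r; apply; apply: sge01.
Qed.

Lemma fil_pi j (m : int) y : fil j y -> fil (j + al * m) (cst (pi%:F ^ m) *: y).
Proof. by apply: filZ; apply/sge_cst/kge_pi. Qed.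

Lemma fil_maxW j y : fil (j + 1) y -> fil_max j y.
Proof. by move=> yj; exists y, 0; rewrite scaler0 addr0; split=> //; apply: fil0. Qed.

Lemma fil_maxD j x y : fil_max j x -> fil_max j y -> fil_max j (x + y).
Proof.
move=> [x1 [x2 [h1 h2 ->]]] [y1 [y2 [h3 h4 ->]]].
exists (x1 + y1), (x2 + y2); rewrite scalerDr addrACA.
by split=> //; apply: filD.
Qed.

Lemma fil_maxZ j n (c : K) y : kge c n -> fil_max j y -> fil_max (j + n) (cst c *: y).
Proof.
move=> cn [y1 [y2 [h1 h2 ->]]]; exists (cst c *: y1), (cst c *: y2).
rewrite scalerDr !scalerA mulrC; split=> //.
- by rewrite addrAC; apply: filZ h1; apply: sge_cst.
- by rewrite addrAC; apply: filZ h2; apply: sge_cst.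
Qed.

Lemma fil_maxN j y : fil_max j y -> fil_max j (- y).
Proof.
move=> [y1 [y2 [h1 h2 ->]]]; exists (- y1), (- y2).
by rewrite opprD scalerN; split=> //; apply: filN.
Qed.

(* If [f] lies in the maximal ideal and [s] has valuation [-j-1], then
   [f s = c + u t] where the constant [c] has valuation at least [-j]. *)
Lemma fil_var_regular j y : fil j y -> fil (j + be + 1) (u *: y) -> fil (j + 1) y.
Proof.
move=> yj uyj s sj; apply: W_reflexive => f f0 f1.
rewrite scalerA (powser_decomp (f * s)) scalerDl; apply: WD.
  apply: yj; apply: sge_cst; rewrite powserM0.
  apply: kge_le (kgeM f1 (sj 0%N)); rewrite le_eqVlt; apply/orP; left.
  by rewrite mulr0; apply/eqP; ring.
rewrite mulrC -scalerA; apply: uyj.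
rewrite (_ : - (j + be + 1) = 0 + - (j + 1) - be); last by ring.
by apply: sge_shift; apply: sgeM.
Qed.

Section Family.
Variables (r : nat) (deg : 'I_r -> int) (e : 'I_r -> L).

(** Graded linear independence of the classes of the [e k] modulo [fil_max]: in a vanishing
    combination of degree [t], each coefficient has zero class, that is, larger valuation than its
    degree requires. *)
Definition fil_indep : Prop := forall t (c : 'I_r -> K),
  (forall k, kge (c k) (t - deg k)) -> fil_max t (\sum_k cst (c k) *: e k) ->
  forall k, kge (c k) (t + 1 - deg k).

Hypothesis e_deg : forall k, fil (deg k) (e k).
Hypothesis e_indep : fil_indep.

Lemma fil_comb t (c : 'I_r -> powser K) :
  (forall k, sge (t - deg k) (c k)) -> fil t (\sum_k c k *: e k).
Proof.
move=> ct; apply: fil_sum => k _.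
rewrite (_ : t = deg k + (t - deg k)); last by ring.
exact: filZ.
Qed.

(** The terms beyond the constant ones form a multiple of [u], so independence improves the constant
    terms by one degree. Once these are removed, [fil_var_regular] divides the rest by [u], and the
    shifted series satisfy the same hypotheses. *)
Lemma fil_indep_coef (l : nat) t (c : 'I_r -> powser K) :
  (forall k, sge (t - deg k) (c k)) -> fil (t + 1) (\sum_k c k *: e k) ->
  forall k, kge (c k l) (t + 1 - deg k - be * l%:Z).
Proof.
have addr_solve (a b b' : L) : a = b + b' -> b = a - b' by move=> ->; rewrite addrK.
have split_sum (c' : 'I_r -> powser K) : \sum_k c' k *: e k =
    \sum_k cst (c' k 0%N) *: e k + u *: \sum_k shift (c' k) *: e k.
  rewrite scaler_sumr -big_split /=; apply: eq_bigr => k _.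
  by rewrite scalerA -scalerDl -powser_decomp.
have shift_deg t' (c' : 'I_r -> powser K) : (forall k, sge (t' - deg k) (c' k)) ->
    forall k, sge (t' - be - deg k) (shift (c' k)).
  by move=> H k; rewrite addrAC; apply: sge_shift.
have coef0 t' (c' : 'I_r -> powser K) : (forall k, sge (t' - deg k) (c' k)) ->
    fil (t' + 1) (\sum_k c' k *: e k) -> forall k, kge (c' k 0%N) (t' + 1 - deg k).
  move=> ct ft; apply: e_indep => [k|].
    by have := ct k 0%N; rewrite mulr0 subr0.
  exists (\sum_k c' k *: e k), (- \sum_k shift (c' k) *: e k); split.
  - exact: ft.
  - by apply/filN/fil_comb/shift_deg.
  - by rewrite scalerN; apply: addr_solve (split_sum c').
elim: l t c => [|l IH] t c ct ft k.
  by rewrite mulr0 subr0; apply: coef0.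
rewrite (_ : _ - _ = t - be + 1 - deg k - be * l%:Z); last first.
  by rewrite -addn1 PoszD; ring.
apply: (IH _ (fun k => shift (c k))); first exact: shift_deg.
apply: fil_var_regular; first exact/fil_comb/shift_deg.
rewrite (_ : _ + 1 = t + 1); last by ring.
rewrite (addr_solve _ _ _ (etrans (split_sum c) (addrC _ _))).
apply: filD; [exact: ft|apply: filN; apply: fil_comb => k'].
by apply: sge_cst; rewrite addrC; apply: kge_le (coef0 _ _ ct ft k'); lia.
Qed.

Lemma deg_bound : exists J : nat, forall k, `|deg k| <= J%:Z.
Proof.
exists (\max_k `|deg k|%N)%N => k.
by rewrite -abszE lez_nat (@leq_bigmax _ (fun k => `|deg k|%N)).
Qed.

(** Zero lies in every [fil], so [fil_indep_coef] applies again and again and pushes all valuations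
    to infinity. *)
Lemma fil_indep_free (c : 'I_r -> powser K) :
  (forall k, sge 0 (c k)) -> \sum_k c k *: e k = 0 -> forall k, c k = 0.
Proof.
move=> c0 ce0 k; have [J HJ] := deg_bound.
suff H (m : nat) : forall k, sge (m%:Z - J%:Z - deg k) (c k).
  apply/funext => l; apply: (@kge_eq0 _ nu) => n.
  have := H (`|n| + J + `|deg k| + `|(be * l%:Z)%R|)%N k l.
  by apply: kge_le; lia.
elim: m => [|m IH] k'.
  by apply: sge_le (c0 k'); have := HJ k'; lia.
move=> l; rewrite (_ : m.+1%:Z - J%:Z = m%:Z - J%:Z + 1); last by lia.
apply: fil_indep_coef => //; rewrite ce0; exact: fil0.
Qed.
End Family.

(** Multiplied by a large power of [pi], the [e k] lie in [W], hence have entries in [S_nu]. More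
    than [d] of them would be linearly dependent, against [fil_indep_free]. *)
Lemma fil_indep_le r (deg : 'I_r -> int) (e : 'I_r -> L) :
  (forall k, fil (deg k) (e k)) -> fil_indep deg e -> (r <= d)%N.
Proof.
move=> e_deg e_ind; rewrite leqNgt; apply/negP => dr.
have [J HJ] := deg_bound deg.
have Wp k : W (cst (pi%:F ^ J%:Z) *: e k).
  apply/fil0P; apply: fil_le (fil_pi (m := J%:Z) (e_deg k)).
  have : J%:Z <= al * J%:Z by rewrite ler_peMl // -gtz0_ge1 al_gt0.
  by have := HJ k; lia.
pose v k l : Snu R nu :=
  SnuOf (iffRL (in_Snu_sge nu _) (W_integral (Wp k) l)).
have [c [k ck] cv] := linear_dependence (@Snu_mul_eq0 R nu) v dr.
apply: ck; apply: Snu_series_inj; rewrite Snu_series0.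
apply: (fil_indep_free e_deg e_ind (c := fun k => Snu_series (c k))).
  by move=> k'; apply: Snu_series_sge.
apply/rowP => l; rewrite summxE mxE.
have /(congr1 (@Snu_series R nu)) := cv l.
rewrite Snu_series_sum Snu_series0 => cvl.
have pp : cst (pi%:F ^ (- J%:Z)) * cst (pi%:F ^ J%:Z) = 1 :> powser K.
  by rewrite -cstM -expfzDr ?uniformizerF_neq0 // addNr expr0z cst1.
suff H : \sum_i cst (pi%:F ^ J%:Z) * ((Snu_series (c i) *: e i) ord0 l) = 0.
  by rewrite -[LHS]mul1r -pp -mulrA mulr_sumr H mulr0.
rewrite -[RHS]cvl; apply: eq_bigr => i _.
by rewrite scaler_rowE mulrCA -scaler_rowE Snu_seriesM.
Qed.

(** Independent families have at most [d] members, so one of maximal size exists; a vector [y] that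
    it failed to reach modulo [fil_max] could be adjoined to it. *)
Lemma fil_basis : exists (r : nat) (deg : 'I_r -> int) (e : 'I_r -> L),
  [/\ (r <= d)%N, forall k, fil (deg k) (e k) &
    forall j y, fil j y -> exists2 c : 'I_r -> K, forall k, kge (c k) (j - deg k) &
      fil_max j (y - \sum_k cst (c k) *: e k)].
Proof.
pose P r := `[< exists (deg : 'I_r -> int) (e : 'I_r -> L),
  (forall k, fil (deg k) (e k)) /\ fil_indep deg e >].
have P0 : exists r, P r.
  exists 0%N; apply/asboolP; exists (fun=> 0), (fun=> 0).
  by split=> [[]|t c _ _ []].
have Pd r : P r -> (r <= d)%N.
  by move=> /asboolP[deg [e [e_deg e_ind]]]; apply: fil_indep_le e_deg e_ind.
have [r /asboolP[deg [e [e_deg e_ind]]] rmax] := ex_maxnP P0 Pd.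
exists r, deg, e; split=> // [|j y yj]; first exact: fil_indep_le e_deg e_ind.
apply: contrapT => Hy.
pose deg' (k : 'I_r.+1) := oapp deg j (unlift ord0 k).
pose e' (k : 'I_r.+1) := oapp e y (unlift ord0 k).
suff /rmax : P r.+1 by rewrite ltnn.
apply/asboolP; exists deg', e'; split=> [k|t c ct].
  by rewrite /deg' /e'; case: (unliftP ord0 k) => [k' _|_] //=; apply: e_deg.
rewrite big_ord_recl {1}/e' unlift_none /=.
under eq_bigr do rewrite /e' liftK /=.
set S := \sum_(k < r) _; move=> maxS.
have ct0 : kge (c ord0) (t - j) by have := ct ord0; rewrite /deg' unlift_none.
have ctl k : kge (c (lift ord0 k)) (t - deg k).
  by have := ct (lift ord0 k); rewrite /deg' liftK.
(* Either the coefficient of [y] has zero class and the relation is one among the [e k], or dividing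
   by it expresses [y] through them. *)
have [c0|[c0 ci]] := kge_inv ct0.
  have mS : fil_max t S.
    rewrite -[S](addKr (cst (c ord0) *: y)) addrC.
    apply: fil_maxD => //; apply/fil_maxN/fil_maxW.
    rewrite (_ : t + 1 = j + (t - j + 1)); last by ring.
    by apply: filZ yj; apply: sge_cst.
  move=> k; rewrite /deg'; case: (unliftP ord0 k) => [k' ->|->] /=.
    exact: (e_ind t (fun k => c (lift ord0 k)) ctl mS k').
  by rewrite addrAC.
case: Hy; exists (fun k => - ((c ord0)^-1 * c (lift ord0 k))) => [k|].
  apply: kgeN; apply: kge_le (kgeM ci (ctl k)).
  by rewrite le_eqVlt; apply/orP; left; apply/eqP; ring.
have -> : y - \sum_k cst (- ((c ord0)^-1 * c (lift ord0 k))) *: e k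
    = cst (c ord0)^-1 *: (cst (c ord0) *: y + S).
  rewrite scalerDr scalerA -cstM mulVf // cst1 scale1r; congr (_ + _).
  rewrite scaler_sumr -sumrN; apply: eq_bigr => k _.
  by rewrite scalerA -cstM -scaleNr; congr (_ *: _); apply/funext => -[|i];
    rewrite powserNE !cstE //= ?opprK ?oppr0.
rewrite (_ : j = t - (t - j)); last by ring.
exact: fil_maxZ.
Qed.

(** [fil_basis] works modulo [pi^(1/al)] and [u], whereas Nakayama's lemma over [S_nu] needs
    elements of [S_nu]. Iteration reaches [pi] and [u^al / pi^be], both of degree zero. *)
Lemma reflexive_generators : exists (r : nat) (deg : 'I_r -> int) (e : 'I_r -> L),
  [/\ (r <= d)%N, forall k, fil (deg k) (e k) &
    forall w, W w -> exists (c : 'I_r -> powser K) (w1 w2 : L),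
      [/\ forall k, sge (- deg k) (c k), W w1, W w2 &
        w = \sum_k c k *: e k + cst pi%:F *: w1
            + (cst (pi%:F ^ (- be)) * u ^+ `|al|) *: w2]].
Proof.
have [r [deg [e [rd e_deg gen]]]] := fil_basis.
exists r, deg, e; split=> // w Ww.
pose G j y := exists2 c : 'I_r -> powser K,
  (forall k, sge (j - deg k) (c k)) & y = \sum_k c k *: e k.
have G0 j : G j 0.
  by exists (fun=> 0) => [k|]; [apply: sge0|rewrite big1 // => k _; rewrite scale0r].
have GD j x y : G j x -> G j y -> G j (x + y).
  move=> [c cj ->] [c' cj' ->]; exists (fun k => c k + c' k) => [k|].
    exact: sgeD.
  by rewrite -big_split; apply: eq_bigr => k _; rewrite scalerDl.
have GZ i j s y : sge i s -> G j y -> G (j + i) (s *: y).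
  move=> si [c cj ->]; exists (fun k => s * c k) => [k|].
    by rewrite (_ : j + i - deg k = i + (j - deg k)); [apply: sgeM|ring].
  by rewrite scaler_sumr; apply: eq_bigr => k _; rewrite scalerA.
have Gle i j y : i <= j -> G j y -> G i y.
  by move=> ij [c cj ->]; exists c => // k; apply: sge_le (cj k); rewrite lerD2r.
(* Each round gains one degree in [y1] and collects the multiples of [u] in [y2]. *)
have step_pi (m : nat) j y : fil j y -> exists g y1 y2,
    [/\ G j g, fil (j + m%:Z) y1, fil (j - be) y2 & y = g + y1 + u *: y2].
  elim: m => [|m IH] yj.
    exists 0, y, 0; rewrite addr0 scaler0 addr0 add0r.
    by split=> //; apply: fil0.
  have [g [y1 [y2 [gj fy1 fy2 ->]]]] := IH yj.
  have [c cj [z1 [z2 [fz1 fz2 yE]]]] := gen _ _ fy1.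
  set S := \sum_k _ in yE.
  exists (g + S), z1, (z2 + y2); split.
  - apply: (GD) => //; apply: (Gle _ (j + m%:Z)); first by rewrite lerDl.
    by exists (fun k => cst (c k)) => // k; apply: sge_cst.
  - by rewrite -addn1 PoszD addrA.
  - by apply: filD => //; apply: fil_le fz2; rewrite lerD2r lerDl.
  - by rewrite -[y1](subrK S) yE scalerDr; move: (u *: z2) => a; move: (u *: y2) => b;
      rewrite [z1 + a + S]addrC !addrA.
(* Each round gains a factor [u]; [al] rounds of [step_pi] make the part without it divisible by
   [pi]. *)
have step_var (m : nat) j y : fil j y -> exists g y1 y2,
    [/\ G j g, fil (j + al) y1, fil (j - be * m%:Z) y2 & y = g + y1 + u ^+ m *: y2].
  elim: m => [|m IH] yj.
    exists 0, 0, y; rewrite mulr0 subr0 add0r expr0 scale1r add0r.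
    by split=> //; apply: fil0.
  have [g [y1 [y2 [gj fy1 fy2 ->]]]] := IH yj.
  have [g' [z1 [z2 [gj' fz1 fz2 ->]]]] := step_pi `|al|%N _ _ fy2.
  have um : sge (be * m%:Z) (u ^+ m) by apply: sge_varX.
  exists (g + u ^+ m *: g'), (y1 + u ^+ m *: z1), z2; split.
  - by apply: (GD) => //; rewrite -[j](subrK (be * m%:Z)); apply: GZ.
  - apply: filD => //; rewrite (_ : j + al = j - be * m%:Z + al + be * m%:Z); last by ring.
    by apply: filZ => //; move: fz1; rewrite gez0_abs // ltW // al_gt0.
  - by rewrite -addn1 PoszD mulrDr mulr1 opprD addrA.
  - rewrite !scalerDr scalerA -exprSr.
    move: (u ^+ m *: g') => a; move: (u ^+ m *: z1) => b; move: (_ *: z2) => b'.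
    by rewrite !addrA; congr (_ + _ + _); rewrite addrAC.
have [g [y1 [y2 [[c c0 ->] fy1 fy2 ->]]]] := step_var `|al|%N 0 w (iffRL (fil0P w) Ww).
have cstV (m : int) : cst (pi%:F ^ m) * cst (pi%:F ^ (- m)) = 1 :> powser K.
  by rewrite -cstM -expfzDr ?uniformizerF_neq0 // subrr expr0z cst1.
have al0 : 0 <= al by rewrite ltW // al_gt0.
have y1E : cst pi%:F *: (cst (pi%:F ^ (-1)) *: y1) = y1.
  by have := cstV 1; rewrite expr1z scalerA => ->; rewrite scale1r.
have y2E : (cst (pi%:F ^ (- be)) * u ^+ `|al|) *: (cst (pi%:F ^ be) *: y2) = u ^+ `|al| *: y2.
  by rewrite scalerA mulrAC -{2}[be]opprK cstV mul1r.
exists c, (cst (pi%:F ^ (-1)) *: y1), (cst (pi%:F ^ be) *: y2); split.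
- by move=> k; have := c0 k; rewrite add0r.
- apply/fil0P; have := fil_pi (m := -1) fy1.
  by rewrite add0r mulrN1 subrr.
- apply/fil0P; have := fil_pi (m := be) fy2.
  by rewrite add0r gez0_abs // mulrC addNr.
- by rewrite y1E y2E.
Qed.
End Reflexive.

(** Every term of [s] is an [S_nu]-multiple of one of the [k] monomials. Grouping the terms by the
    monomial chosen for them gives the coefficients, with no convergence to check. *)
Lemma monomial_gens (R : completeDvrType) (nu : rat) (k : nat) (q : int) :
  line_gens nu k ->
  exists2 g : 'I_k -> powser {fraction R}, forall l, sge nu q (g l) &
    forall s, sge nu q s -> exists2 c : 'I_k -> powser {fraction R},
      forall l, sge nu 0 (c l) & s = \sum_l c l * g l.
Proof.
set al := denq nu; set be := numq nu.
have al0 : 0 < al%:~R :> rat by rewrite ltr0z; apply: al_gt0.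
have nuE : nu * al%:~R = be%:~R.
  by rewrite -[nu in LHS]divq_num_den mulfVK // gt_eqF.
have linE (m : int) (i : nat) :
    below_line nu (- (q%:~R / al%:~R)) (i, - m) = (q <= al * m + be * i%:Z).
  rewrite /below_line /= -(ler_pM2r al0) mulrDl mulNr mulfVK ?gt_eqF // mulrAC nuE.
  by rewrite -(ler_int rat) rmorphD !rmorphM rmorphN /= -pmulrn -subr_ge0;
    rewrite -[RHS]subr_ge0; congr (0 <= _); ring.
move=> /(_ (- (q%:~R / al%:~R)))[pts [size_pts /allP below_pts dom_pts]].
(* This point pads the list up to length [k]; it must itself lie below the line. *)
pose p0 := (0%N, Num.floor (- (q%:~R / al%:~R) : rat)).
have below0 : below_line nu (- (q%:~R / al%:~R)) p0.
  by rewrite /below_line /p0 /= mulr0 addr0 floor_le.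
pose p (l : 'I_k) := nth p0 pts l.
have below_p l : q <= al * - (p l).2 + be * (p l).1%:Z.
  rewrite -linE opprK -surjective_pairing /p.
  by have [/(mem_nth p0)/below_pts|/(nth_default p0) ->] := ltnP l (size pts).
pose pi : {fraction R} := (@uniformizer R)%:F.
exists (fun l => cst (pi ^ (- (p l).2)) * var _ ^+ (p l).1) => [l|s sq].
  by apply: sge_le (sgeM (sge_cst (kge_pi R nu _)) (sge_varX R nu _)); apply: below_p.
have /choice[h hP] b : exists l : 'I_k, ((p l).1 <= b)%N /\
    kge nu (s b * pi ^ (p l).2) (- be * (b - (p l).1)%:Z).
  have [r [m [sb mb]]] := sq b.
  have [|q' q'pts] := dom_pts (b, - m); first by rewrite linE; move: mb; lia.
  rewrite /dominates /= => /andP[q'b q'm].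
  have ltk : (index q' pts < k)%N by apply: leq_trans size_pts; rewrite index_mem.
  exists (Ordinal ltk); rewrite /p /= nth_index //; split=> //.
  rewrite sb -mulrA -expfzDr ?uniformizerF_neq0 //; exists r, (m + q'.2); split=> //.
  move: q'm; rewrite -(ler_pM2r al0) -natrB // mulrAC nuE -(ler_int rat).
  by rewrite !rmorphM !rmorphD !rmorphN /= -pmulrn; lra.
(* The terms assigned to [l], divided by the [l]-th monomial. *)
exists (fun l i => if h (i + (p l).1)%N == l then s (i + (p l).1)%N * pi ^ (p l).2 else 0).
  move=> l i; case: eqP => [hl|_]; last exact: kge0.
  by have [_] := hP (i + (p l).1)%N; rewrite hl addnK sub0r -mulNr.
apply/funext => b; rewrite powser_sumE (bigD1 (h b)) //= big1 => [|l lh].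
  have [hb _] := hP b.
  rewrite addr0 mulrCA cstME [_ * var _ ^+ _]mulrC varXME // ltnNge hb /= subnK // eqxx.
  by rewrite mulrCA -expfzDr ?uniformizerF_neq0 // addNr expr0z mulr1.
rewrite mulrCA cstME [_ * var _ ^+ _]mulrC varXME; case: ltnP => bp; first by rewrite mulr0.
by rewrite subnK // eq_sym (negPf lh) mulr0.
Qed.

(** * Modules over the local ring *)

Section PowerSeriesInverse.
Variables (F : fieldType) (f : powser F).

(** Each coefficient of the inverse depends on all earlier ones, so the recursion carries the list
    of them. *)
Fixpoint powser_inv_seq n : seq F :=
  if n is m.+1 then
    let s := powser_inv_seq m in
    rcons s ((f 0%N)^-1 * ((m == 0%N)%:R - \sum_(j < m) s`_j * f (m - j)%N))
  else [::].

Definition powser_inv : powser F := fun n => (powser_inv_seq n.+1)`_n.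

Lemma size_powser_inv_seq n : size (powser_inv_seq n) = n.
Proof. by elim: n => //= n IH; rewrite size_rcons IH. Qed.

Lemma powser_invE n : powser_inv n =
  (f 0%N)^-1 * ((n == 0%N)%:R - \sum_(j < n) powser_inv j * f (n - j)%N).
Proof.
have nthE m j : (j < m)%N -> (powser_inv_seq m)`_j = powser_inv j.
  elim: m => // m IH; rewrite ltnS leq_eqVlt => /predU1P[->//|jm].
  by rewrite /= nth_rcons size_powser_inv_seq jm IH.
rewrite {1}/powser_inv /= nth_rcons size_powser_inv_seq ltnn eqxx.
by congr (_ * (_ - _)); apply: eq_bigr => j _; rewrite nthE.
Qed.

Lemma powser_invM : f 0%N != 0 -> powser_inv * f = 1.
Proof.
move=> f0; apply/funext => n; rewrite powserME big_ord_recr /= subnn powser_invE.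
by rewrite mulrAC mulVf // mul1r subrKC.
Qed.
End PowerSeriesInverse.

Section LocalRing.
Variables (R : completeDvrType) (nu : rat).
Local Notation S := (Snu R nu).
Implicit Types (f g : S).

(** The maximal ideal of [S_nu]. Only the constant term matters: a term of positive degree may have
    Gauss valuation zero without making [f] a unit. *)
Definition Snu_max f : Prop := kge nu (Snu_series f 0%N) 1.

Lemma Snu_maxD f g : Snu_max f -> Snu_max g -> Snu_max (f + g).
Proof. by move=> fm gm; rewrite /Snu_max Snu_seriesD; apply: kgeD. Qed.

Lemma Snu_coef0 f : kge nu (Snu_series f 0%N) 0.
Proof. by have := Snu_series_sge f 0%N; rewrite mulr0 subr0. Qed.

Lemma Snu_maxM f g : Snu_max f -> Snu_max (g * f).
Proof.
move=> fm; rewrite /Snu_max Snu_seriesM powserM0 -[1]add0r.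
by apply: kgeM => //; apply: Snu_coef0.
Qed.

Lemma Snu_max1 : ~ Snu_max 1.
Proof.
rewrite /Snu_max Snu_series1 => k1.
suff /eqP : 1 = 0 :> {fraction R} by rewrite oner_eq0.
apply: (@kge_eq0 _ nu) => n.
have nat1 (m : nat) : kge nu (1 : {fraction R}) m%:Z.
  elim: m => [|m IH]; first by rewrite -tofrac1; apply: kge_tofrac.
  by have := kgeM k1 IH; rewrite mulr1 -[m.+1]add1n PoszD.
by apply: kge_le (nat1 `|n|%N); rewrite abszE ler_norm.
Qed.

(** The inverse is computed in [K[[u]]]; induction on its coefficients shows that it stays in
    [S_nu]. *)
Lemma Snu_unit f : ~ Snu_max f -> exists g, g * f = 1.
Proof.
move=> fm; have [|[f0 fi]] := kge_inv (Snu_coef0 f); first by rewrite add0r.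
pose g := powser_inv (Snu_series f).
have g0 n : kge nu (g n) (0 - numq nu * n%:Z).
  have [m] := ubnP n; elim: m n => // m IH n nm; rewrite /g powser_invE.
  rewrite -[0 - _]add0r -[X in kge _ _ (X + _)]oppr0; apply: kgeM => //; apply: kgeD.
    case: n {nm} => [|n]; last exact: kge0.
    by rewrite mulr0 subr0 -tofrac1; apply: kge_tofrac.
  apply: kgeN; apply: kge_sum => j _.
  apply: kge_le (kgeM (IH j _) (Snu_series_sge f (n - j)%N)).
    rewrite le_eqVlt; apply/orP; left; rewrite -subzn 1?ltnW //; apply/eqP; ring.
  by apply: leq_trans (ltn_ord j) _.
have [h hE] := Snu_seriesP (s := g) g0; exists h.
by apply: Snu_series_inj; rewrite Snu_seriesM hE Snu_series1 powser_invM.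
Qed.

Lemma Snu_unit1B f : Snu_max f -> exists g, g * (1 - f) = 1.
Proof.
by move=> fm; apply: Snu_unit => /(Snu_maxD fm); rewrite subrKC => /Snu_max1.
Qed.

(** The auxiliary generators [y] are discarded one at a time: modulo the others and [G], the first
    one is a multiple of itself by an element of the maximal ideal. *)
Lemma nakayama (V : lmodType S) (T : finType) (G : T -> V) (p q : S) :
  Snu_max p -> Snu_max q -> finitely_generated V ->
  (forall w, exists (c : T -> S) (w1 w2 : V),
     w = \sum_t c t *: G t + p *: w1 + q *: w2) ->
  forall w, exists c : T -> S, w = \sum_t c t *: G t.
Proof.
move=> pm qm [k [y ygen]] Gpq.
have {ygen} : forall w, exists (c : T -> S) (c' : 'I_k -> S),
    w = \sum_t c t *: G t + \sum_i c' i *: y i.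
  move=> w; have [c ->] := ygen w; exists (fun=> 0), c.
  by rewrite [X in X + _]big1 ?add0r // => t _; rewrite scale0r.
elim: k y => [|k IH] y ygen.
  by move=> w; have [c [c' ->]] := ygen w; exists c; rewrite big_ord0 addr0.
apply: (IH (fun i => y (lift ord0 i))).
pose Sp w := exists (c : T -> S) (c' : 'I_k -> S),
  w = \sum_t c t *: G t + \sum_i c' i *: y (lift ord0 i).
have SpD x z : Sp x -> Sp z -> Sp (x + z).
  move=> [a [a' ->]] [b [b' ->]].
  exists (fun t => a t + b t), (fun i => a' i + b' i).
  by rewrite addrACA -!big_split; congr (_ + _); apply: eq_bigr => ? _; rewrite scalerDl.
have SpZ s x : Sp x -> Sp (s *: x).
  move=> [a [a' ->]]; exists (fun t => s * a t), (fun i => s * a' i).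
  by rewrite scalerDr !scaler_sumr; congr (_ + _); apply: eq_bigr => ? _; rewrite scalerA.
have SpG (c : T -> S) : Sp (\sum_t c t *: G t).
  exists c, (fun=> 0); rewrite [X in _ + X]big1 ?addr0 // => i _.
  by rewrite scale0r.
have Spy w : exists z s, Sp z /\ w = z + s *: y ord0.
  have [c [c' ->]] := ygen w.
  exists (\sum_t c t *: G t + \sum_i c' (lift ord0 i) *: y (lift ord0 i)), (c' ord0).
  by split; [exists c, (fun i => c' (lift ord0 i))|rewrite big_ord_recl addrA addrAC].
have Sp0 : Sp (y ord0).
  have [c [w1 [w2 yE]]] := Gpq (y ord0).
  have [z1 [s1 [Sz1 w1E]]] := Spy w1; have [z2 [s2 [Sz2 w2E]]] := Spy w2.
  have [g gE] := Snu_unit1B (Snu_maxD (Snu_maxM s1 pm) (Snu_maxM s2 qm)).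
  rewrite -[y ord0]scale1r -gE -scalerA; apply: (SpZ).
  rewrite (_ : _ *: _ = \sum_t c t *: G t + p *: z1 + q *: z2).
    apply: (SpD); last exact: (SpZ).
    by apply: (SpD); [apply: (SpG)|apply: (SpZ)].
  rewrite scalerBl scale1r; apply/eqP; rewrite subr_eq; apply/eqP.
  rewrite {1}yE w1E w2E !scalerDr !scalerA scalerDl [s1 * p]mulrC [s2 * q]mulrC.
  move: (\sum_t _) (p *: _) (q *: _) ((p * s1) *: _) ((q * s2) *: _) => a b1 b2 b3 b4.
  by rewrite !addrA; congr (_ + _); rewrite addrAC; congr (_ + _); rewrite addrAC.
by move=> w; have [z [s [Sz ->]]] := Spy w; apply: (SpD) => //; apply: (SpZ).
Qed.

Lemma generated_by_card (A : comNzRingType) (V : lmodType A) (T : finType) (G : T -> V) :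
  (forall w, exists c : T -> A, w = \sum_t c t *: G t) -> generated_by V #|T|.
Proof.
move=> gen; exists (fun i => G (enum_val i)) => w; have [c ->] := gen w.
exists (fun i => c (enum_val i)); exact: (reindex _ (onW_bij _ (@enum_val_bij T))).
Qed.

(** If [p^l y] were outside [P], the submodules [P + S p^i y] would form a strict chain longer than
    allowed: an equality between neighbours puts [p^i y] in [P], since [1 - s p] is a unit. *)
Lemma finite_length_annihilated (V : lmodType S) (P Q : {pred V}) (p : S) :
  Snu_max p -> GRing.submod_closed P -> GRing.submod_closed Q ->
  {subset P <= Q} -> quotient_finite_length P Q ->
  exists l : nat, forall y, y \in Q -> p ^+ l *: y \in P.
Proof.
move=> pm [P0 PD] [Q0 QD] PQ [l lmax]; exists l => y yQ.
have PZ a x : x \in P -> a *: x \in P by move=> xP; rewrite -[_ *: _]addr0; apply: PD.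
have QZ a x : x \in Q -> a *: x \in Q by move=> xQ; rewrite -[_ *: _]addr0; apply: QD.
have QA x z : x \in Q -> z \in Q -> x + z \in Q.
  by move=> xQ; rewrite -[x]scale1r; apply: QD.
apply: contrapT => yP.
pose C i : {pred V} := [pred x | `[< exists x1 s,
  x1 \in P /\ x = x1 + (s * p ^+ (l.+1 - i)) *: y >]].
suff : (l.+1 <= l)%N by rewrite ltnn.
apply: (lmax _ C) => i il; split.
- split.
    by apply/asboolP; exists 0, 0; rewrite mul0r scale0r addr0.
  move=> a x z /asboolP[x1 [s [x1P ->]]] /asboolP[z1 [t [z1P ->]]].
  apply/asboolP; exists (a *: x1 + z1), (a * s + t); split; first exact: PD.
  by rewrite scalerDr addrACA scalerA -scalerDl mulrDl mulrA.
- by move=> x xP; apply/asboolP; exists x, 0; rewrite mul0r scale0r addr0.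
- by move=> _ /asboolP[x1 [s [x1P ->]]]; apply: QA; [apply: PQ|apply: QZ].
- move=> _ /asboolP[x1 [s [x1P ->]]]; apply/asboolP; exists x1, (s * p).
  by rewrite subSn // -mulrA -exprS subSS.
move=> sub; apply: yP.
have /asboolP[x1 [s [x1P yE]]] : p ^+ (l - i) *: y \in C i.
  by apply: sub; apply/asboolP; exists 0, 1; rewrite add0r mul1r subSS.
have [g gE] := Snu_unit1B (Snu_maxM s pm).
have yiP : p ^+ (l - i) *: y \in P.
  rewrite -[_ *: y]scale1r -gE -scalerA; apply: PZ.
  rewrite scalerBl scale1r {1}yE subSn // exprS mulrA scalerA addrK //.
rewrite -(subnK (_ : i <= l)%N) // addnC exprD -scalerA.
exact: PZ.
Qed.

(** The hypotheses make [T] at most one simple step larger than [Q], so intersecting a chain with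
    [Q] loses at most one strict inclusion. *)
Lemma finite_length_extend (V : lmodType S) (P Q T : {pred V}) (y : V) :
  GRing.submod_closed Q ->
  (forall x, x \in T -> exists q s, q \in Q /\ x = q + s *: y) ->
  (forall f, Snu_max f -> f *: y \in Q) ->
  {subset P <= Q} -> quotient_finite_length P Q -> quotient_finite_length P T.
Proof.
move=> [Q0 QD] TQ yQ PQ [l lmax]; exists l.+1 => n C Csub Cstrict.
case: n => // n in Csub Cstrict *; rewrite ltnS.
have QA x z : x \in Q -> z \in Q -> x + z \in Q.
  by move=> xQ; rewrite -[x]scale1r; apply: QD.
have QZ a x : x \in Q -> a *: x \in Q by move=> xQ; rewrite -[_ *: _]addr0; apply: QD.
have Cmono i j : (i <= j <= n.+1)%N -> {subset C i <= C j}.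
  move=> /andP[]; elim: j => [|j IH]; first by rewrite leqn0 => /eqP -> _ x.
  rewrite leq_eqVlt => /predU1P[-> _ x //|ij] jn x xi.
  by have [+ _] := Cstrict j jn; apply; apply: IH xi => //; apply: ltnW.
have [CQ|NQ] := pselect (forall i, (i <= n.+1)%N -> {subset C i <= Q}).
  apply: ltnW; apply: (lmax _ C) => // i i_n.
  by have [? ? _] := Csub i i_n; split=> //; apply: CQ.
have {}NQ : exists i, ((i <= n.+1)%N && ~~ `[< {subset C i <= Q} >]).
  apply: contrapT => H; apply: NQ => i i_n; apply: contrapT => iQ; apply: H.
  by exists i; rewrite i_n; apply/asboolPn.
have [j /andP[jn /asboolPn jQ] jmin] := ex_minnP NQ.
have ltjQ i : (i < j)%N -> {subset C i <= Q}.
  move=> ij; apply: contrapT => iQ.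
  suff /jmin : (i <= n.+1)%N && ~~ `[< {subset C i <= Q} >] by rewrite leqNgt ij.
  by rewrite (leq_trans (ltnW ij)) //=; apply/asboolPn.
(* Beyond [j], the chain contains a vector [y + q] with [q] in [Q]. *)
have [q [qQ yqC]] : exists q, q \in Q /\ y + q \in C j.
  have [x [xC xQ]] : exists x, x \in C j /\ x \notin Q.
    apply: contrapT => H; apply: jQ => x xC; apply: contrapT => /negP xQ.
    by apply: H; exists x.
  have [[C0 CD] _ CT] := Csub j jn.
  have [q [s [qQ xE]]] := TQ x (CT x xC).
  have sm : ~ Snu_max s by move=> /yQ syQ; move: xQ; rewrite xE QA.
  have [g gs] := Snu_unit sm; exists (g *: q); split; first exact: QZ.
  rewrite -[y]scale1r -gs -scalerA -scalerDr addrC -xE -[_ *: x]addr0.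
  exact: CD.
(* A multiple of [y + q], already in [C i], is subtracted from a new vector; the result lies in [Q]
   and is still new. *)
have strictQ i : (j <= i <= n)%N -> exists z, [/\ z \in C i.+1, z \in Q & z \notin C i].
  move=> /andP[ji i_n].
  have [z [zC zN]] : exists z, z \in C i.+1 /\ z \notin C i.
    apply: contrapT => H; have [_] := Cstrict i i_n; apply=> z zC.
    by apply: contrapT => /negP zN; apply: H; exists z.
  have [[C0 CD] _ CT] := Csub i.+1 i_n.
  have [[D0 DD] _ _] := Csub i (leqW i_n).
  have [q' [s [q'Q zE]]] := TQ z (CT z zC).
  have yqi : y + q \in C i by apply: Cmono yqC; rewrite ji leqW.
  exists (- s *: (y + q) + z); split.
  - by apply: CD => //; apply: Cmono yqi; rewrite leqnSn.
  - rewrite zE scalerDr scaleNr [q' + _]addrC addrACA addrA addrAC addNr add0r.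
    by apply: QA => //; apply: QZ.
  - apply: contra zN => H; rewrite -[z](addKr (- s *: (y + q))) -scaleNr opprK.
    exact: DD.
(* The index [j], at which the chain first leaves [Q], is skipped. *)
pose C' i : {pred V} := [pred x | (x \in C (i + (j <= i)%N)%N) && (x \in Q)].
apply: (lmax _ C') => i i_n.
  have i'n : (i + (j <= i) <= n.+1)%N by rewrite -addn1 leq_add // leq_b1.
  have [[C0 CD] CP _] := Csub _ i'n; split.
  - split; first by rewrite inE C0 Q0.
    by move=> a x z /andP[? ?] /andP[? ?]; apply/andP; split; [apply: CD|apply: QD].
  - by move=> x xP; apply/andP; split; [apply: CP|apply: PQ].
  - by move=> x /andP[].
have le_idx : (i + (j <= i) <= i.+1 + (j <= i.+1) <= n.+1)%N.
  by case: (leqP j i) => ji; case: (leqP j i.+1) => ji'; lia.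
split=> [x /andP[xC xQ]|sub].
  by apply/andP; split=> //; apply: Cmono xC.
have [ji|ij] := leqP j i.+1.
  have [|z [zC zQ /negP zN]] := strictQ i.+1; first by rewrite ji.
  apply: zN; have /andP[+ _] : z \in C' i.
    by apply: sub; apply/andP; rewrite ji addn1.
  by apply: Cmono; case: (j <= i)%N; lia.
have [_] := Cstrict i (ltnW i_n); apply=> z zC.
have /andP[] : z \in C' i; last by rewrite leqNgt (ltnW ij) addn0.
apply: sub; apply/andP; rewrite leqNgt ij addn0; split=> //.
exact: ltjQ zC.
Qed.
End LocalRing.

(** * Reflexivity of [Max] *)

Section MaxReflexive.
Variables (A : comNzRingType) (V W : lmodType A) (f : {linear V -> W}) (p : A) (w1 : W).

(** This models [W + S (w1 / p)]; multiplying by [p] keeps it inside [W]. *)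
Definition scaled_adjoin : {pred W} :=
  [pred x | `[< exists w s, x = p *: w + s *: w1 >]].

Fact scaled_adjoin_closed : GRing.submod_closed scaled_adjoin.
Proof.
split; first by apply/asboolP; exists 0, 0; rewrite scaler0 scale0r addr0.
move=> a _ _ /asboolP[w [s ->]] /asboolP[w' [s' ->]]; apply/asboolP.
exists (a *: w + w'), (a * s + s').
by rewrite !scalerDr scalerDl !scalerA [p * a]mulrC addrACA.
Qed.

HB.instance Definition _ := GRing.isSubmodClosed.Build A W scaled_adjoin
  scaled_adjoin_closed.

Local Notation N := (submodule scaled_adjoin).

Lemma scaled_in w : p *: w \in scaled_adjoin.
Proof. by apply/asboolP; exists w, 0; rewrite scale0r addr0. Qed.

Lemma adjoin_in : w1 \in scaled_adjoin.
Proof. by apply/asboolP; exists 0, 1; rewrite scaler0 scale1r add0r. Qed.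

Definition scaled_map (v : V) : N := SubmoduleOf (scaled_in (f v)).

Fact scaled_map_linear : linear scaled_map.
Proof.
move=> a u v; apply: val_inj => /=.
by rewrite linearP scalerDr !scalerA mulrC.
Qed.

HB.instance Definition _ := GRing.isLinear.Build A V N _ scaled_map scaled_map_linear.
End MaxReflexive.

Lemma submodule_torsion_free (A : comNzRingType) (V : lmodType A) (M : submodClosed V) :
  torsion_free V -> torsion_free (submodule M).
Proof.
move=> tf s x /(congr1 val) /= /tf[->|x0]; [by left|right].
exact: val_inj.
Qed.

Lemma lin_im_closed (A : comNzRingType) (V W : lmodType A) (f : {linear V -> W}) :
  GRing.submod_closed (lin_im f).
Proof.
split; first by apply/asboolP; exists 0; rewrite linear0.
move=> a _ _ /asboolP[x ->] /asboolP[y ->]; apply/asboolP.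
by exists (a *: x + y); rewrite linearP.
Qed.

Lemma lin_ker_closed (A : comNzRingType) (V W : lmodType A) (f : {linear V -> W}) :
  GRing.submod_closed (lin_ker f).
Proof.
split; first by rewrite inE linear0.
by move=> a x y; rewrite !inE linearP => /eqP -> /eqP ->; rewrite scaler0 addr0.
Qed.

Lemma submodule_val_sum (A : comNzRingType) (V : lmodType A) (M : submodClosed V)
    (I : Type) (r : seq I) (P : pred I) (F : I -> submodule M) :
  submodule_val (\sum_(i <- r | P i) F i) = \sum_(i <- r | P i) submodule_val (F i).
Proof. exact: (raddf_sum (\val : submodule M -> V)). Qed.

Lemma scaled_adjoin_fg (A : comNzRingType) (W : lmodType A) (p : A) (w1 : W) :
  finitely_generated W -> finitely_generated (submodule (scaled_adjoin p w1)).
Proof.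
move=> [k [y ygen]]; exists k.+1.
exists (fun i => if unlift ord0 i is Some j then SubmoduleOf (scaled_in p w1 (y j))
                 else SubmoduleOf (adjoin_in p w1)).
move=> [x xN]; have /asboolP[w [s xE]] := xN; have [c wE] := ygen w.
exists (fun i => if unlift ord0 i is Some j then c j else s).
apply: val_inj; rewrite /= submodule_val_sum big_ord_recl unlift_none /= xE wE.
rewrite addrC; congr (_ + _); rewrite scaler_sumr.
by apply: eq_bigr => i _; rewrite liftK /= !scalerA mulrC.
Qed.

Section MaxOfSubmodule.
Variables (R : completeDvrType) (nu : rat).
Local Notation S := (Snu R nu).

(* [Max] applied to the quasi-isomorphism [pi f] from [V] to [pi W + S w1]. *)
Lemma max_reflexive (V W : lmodType S) (f : {linear V -> W}) (p : S) (l : nat) (w1 : W) :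
  is_Max f -> p <> 0 -> (forall v, f v = 0 -> v = 0) ->
  (forall w, p ^+ l *: w \in lin_im f) ->
  (forall g, Snu_max g -> exists w, g *: w1 = p *: w) ->
  exists w, w1 = p *: w.
Proof.
move=> [fgW tfW [_ cokf] fmax] p0 finj pl maxw1.
pose N := submodule (scaled_adjoin p w1).
have tfN : torsion_free N by apply: submodule_torsion_free.
pose f' : {linear V -> N} := scaled_map f p w1.
have qis : quasi_isomorphism f'.
  split.
    exists 0%N => n C Csub Cstrict; case: n => // n in Csub Cstrict *.
    have [_] := Cstrict 0%N isT; case=> x x1.
    have [_ _ /(_ x x1)] := Csub 1%N isT; rewrite inE => /eqP /(congr1 val) /= xE.
    have [//|/finj x0] := tfW _ _ xE.
    by have [_ + _] := Csub 0%N isT; apply; rewrite inE x0.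
  pose Q : {pred N} := [pred x | `[< exists w, val x = p *: w >]].
  apply: (@finite_length_extend R nu N _ Q predT (SubmoduleOf (adjoin_in p w1))).
  - split; first by apply/asboolP; exists 0; rewrite scaler0.
    move=> a x y /asboolP[w xE] /asboolP[w' yE]; apply/asboolP.
    by exists (a *: w + w'); rewrite /= xE yE scalerDr !scalerA mulrC.
  - move=> [x xN] _; have /asboolP[w [s xE]] := xN.
    exists (SubmoduleOf (scaled_in p w1 w)), s; split; last exact: val_inj.
    by apply/asboolP; exists w.
  - by move=> g /maxw1[w wE]; apply/asboolP; exists w.
  - by move=> _ /asboolP[v ->]; apply/asboolP; exists (f v).
  have [m mmax] := cokf; exists m => n C Csub Cstrict.
  (* Division by [p] carries chains between the image of [f'] and [p W] to chains between the image
     of [f] and [W]. *)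
  pose C' i : {pred W} := [pred w | `[< exists2 x : N, x \in C i & val x = p *: w >]].
  apply: (mmax _ C') => i i_n.
    have [[C0 CD] CP _] := Csub i i_n; split=> //.
    - split; first by apply/asboolP; exists 0 => //; rewrite scaler0.
      move=> a w w' /asboolP[x xC xE] /asboolP[x' xC' xE']; apply/asboolP.
      by exists (a *: x + x'); [apply: CD|rewrite /= xE xE' scalerDr !scalerA mulrC].
    - move=> _ /asboolP[v ->]; apply/asboolP; exists (f' v) => //.
      by apply: CP; apply/asboolP; exists v.
  have [CC NC] := Cstrict i i_n; split=> [w /asboolP[x xC xE]|C'C].
    by apply/asboolP; exists x => //; apply: CC.
  apply: NC => x xC; have [_ _ CQ] := Csub i.+1 i_n.
  have /asboolP[w xE] := CQ x xC.
  have /asboolP[x' xC' xE'] : w \in C' i by apply: C'C; apply/asboolP; exists x.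
  by rewrite (_ : x = x') //; apply: val_inj; rewrite xE xE'.
have [g gf'] := fmax N f' (scaled_adjoin_fg p w1 fgW) tfN qis.
pose n1 : N := SubmoduleOf (adjoin_in p w1).
exists (g n1); have /asboolP[v vE] := pl w1.
have pl0 : p ^+ l <> 0.
  by elim: l {pl vE} => [|l IH]; [apply/eqP/oner_neq0|rewrite exprS => /Snu_mul_eq0[]].
(* Applying [g] gives [p^l w1 = f v = p^(l+1) g(n1)], and [p^l] cancels by torsion-freeness. *)
have /(congr1 g) : f' v = p ^+ l.+1 *: n1.
  by apply: val_inj; rewrite /= -vE scalerA exprS.
rewrite linearZ [RHS]/= -[g (f' v)]/((g \o f') v) gf' -vE exprSr -scalerA => /eqP.
rewrite -subr_eq0 -scalerBr => /eqP /tfW[//|/eqP].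
by rewrite subr_eq0 => /eqP.
Qed.
End MaxOfSubmodule.

Lemma Snu_row_torsion_free (R : completeDvrType) (nu : rat) (d : nat) :
  torsion_free 'rV[Snu R nu]_d.
Proof.
move=> s x sx; have [s0|s0] := pselect (s = 0); [by left|right].
apply/rowP => k; have /rowP/(_ k) := sx; rewrite !mxE => /Snu_mul_eq0[]//.
Qed.

(** * Embedding of [Max] and count of generators *)

Section MaxEmbedding.
Variables (R : completeDvrType) (nu : rat) (d : nat).
Local Notation S := (Snu R nu).
Local Notation pi := (@uniformizer R).
Local Notation L := 'rV[powser {fraction R}]_d.
Variables (M : submodClosed 'rV[S]_d) (W : lmodType S) (f : {linear submodule M -> W}).
Hypothesis fmax : is_Max f.

Lemma Snu_uniformizer : exists p : S,
  [/\ Snu_series p = cst pi%:F, Snu_max p & p <> 0].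
Proof.
have kp : kge nu (pi%:F : {fraction R}) 1.
  apply: kge_le (_ : kge nu _ (denq nu * 1)).
    by rewrite mulr1 -gtz0_ge1 al_gt0.
  by have := kge_pi R nu 1; rewrite expr1z.
have [p pE] := Snu_seriesP (sge_le (ler01 : 0 <= 1 :> int) (sge_cst kp)).
exists p; split=> //; first by rewrite /Snu_max pE cstE.
move=> /(congr1 (fun g => Snu_series g 0%N)); rewrite pE Snu_series0 cstE /=.
by apply/eqP; rewrite tofrac_eq0 uniformizer_neq0.
Qed.

(* [x] is sent to [f^-1 (pi^l x)], where [pi^l] kills the cokernel of [f]. *)
Lemma max_embedding : exists phi : W -> L,
  [/\ injective phi, {morph phi : x y / x + y},
      forall s x, phi (s *: x) = Snu_series s *: phi x,
      forall x k, sge nu 0 (phi x ord0 k) &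
      forall y, (forall g, sge nu 0 g -> kge nu (g 0%N) 1 ->
        exists w, g *: y = phi w) -> exists w, y = phi w].
Proof.
have [p [pE pm p0]] := Snu_uniformizer.
have [fgW tfW [kerf cokf] _] := fmax.
have tfM : torsion_free (submodule M).
  exact/submodule_torsion_free/Snu_row_torsion_free.
have pl0 l : p ^+ l <> 0.
  by elim: l => [|l IH]; [apply/eqP/oner_neq0|rewrite exprS => /Snu_mul_eq0[]].
have finj v : f v = 0 -> v = 0.
  (* A power of [p] kills the kernel, which lies in a torsion-free module. *)
  move=> fv; have [||l lP] := finite_length_annihilated pm _ (lin_ker_closed f) _ kerf.
  - split; first by rewrite inE.
    by move=> a x y; rewrite !inE => /eqP -> /eqP ->; rewrite scaler0 addr0.
  - by move=> x; rewrite !inE => /eqP ->; rewrite linear0.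
  have := lP v; rewrite !inE fv eqxx => /(_ isT) /eqP /tfM[/pl0|] //.
have [l lP] : exists l, forall w, p ^+ l *: w \in lin_im f.
  have [||l lP] := finite_length_annihilated pm (lin_im_closed f) _ _ cokf => //.
  by exists l => w; apply: lP.
have /choice[psi psiE] w : exists v, f v = p ^+ l *: w.
  by have /asboolP[v ->] := lP w; exists v.
have finj2 u v : f u = f v -> u = v.
  by move=> uv; apply/eqP; rewrite -subr_eq0; apply/eqP/finj; rewrite linearB uv /= subrr.
have psiD x y : psi (x + y) = psi x + psi y.
  by apply: finj2; rewrite linearD !psiE scalerDr.
have psiZ s x : psi (s *: x) = s *: psi x.
  by apply: finj2; rewrite linearZ /= !psiE !scalerA mulrC.
pose phi w : L := \row_k Snu_series (submodule_val (psi w) ord0 k).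
have phiE w k : phi w ord0 k = Snu_series (submodule_val (psi w) ord0 k).
  by rewrite mxE.
have phiD : {morph phi : x y / x + y}.
  move=> x y; apply/rowP => k; rewrite [RHS]mxE !phiE psiD -Snu_seriesD.
  by congr Snu_series; rewrite mxE.
have phiZ s x : phi (s *: x) = Snu_series s *: phi x.
  apply/rowP => k; rewrite scaler_rowE !phiE psiZ -Snu_seriesM.
  by congr Snu_series; rewrite mxE.
have phi_inj : injective phi.
  move=> x y /rowP xy.
  have /eqP : psi x = psi y.
    by apply: val_inj; apply/rowP => k; apply: Snu_series_inj; rewrite -!phiE.
  move=> /eqP/(congr1 f); rewrite !psiE => /eqP; rewrite -subr_eq0 -scalerBr.
  by move=> /eqP/tfW[/pl0|/eqP] //; rewrite subr_eq0 => /eqP.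
exists phi; split=> // [x k|y Hy]; first by rewrite phiE; apply: Snu_series_sge.
have [w1 w1E] : exists w, cst pi%:F *: y = phi w.
  by apply: Hy; [rewrite -pE; apply: Snu_series_sge|rewrite -pE].
(* Here [w1] represents [pi y], and [g (pi y) = pi (g y)] with [g y] in the image, as
   [max_reflexive] requires. *)
have [g gm|w2 w2E] := max_reflexive fmax p0 finj lP (w1 := w1).
  have [w wE] := Hy _ (Snu_series_sge g) gm; exists w.
  by apply: phi_inj; rewrite !phiZ -wE -w1E pE !scalerA mulrC.
exists w2; have ppV : cst (pi%:F^-1) * cst pi%:F = 1 :> powser {fraction R}.
  by rewrite -cstM mulVf ?uniformizerF_neq0 // cst1.
by rewrite -[y]scale1r -ppV -scalerA w1E w2E phiZ pE scalerA ppV scale1r.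
Qed.

(** The coefficients allowed on [e i] form a module with [k] monomial generators. Their products
    with the [e i] generate modulo [pi] and [u^al / pi^be], hence generate by Nakayama's lemma. *)
Lemma max_generated (k : nat) : line_gens nu k ->
  exists2 r : nat, (r <= d)%N & generated_by W (r * k).
Proof.
move=> gens_k.
have [phi [phi_inj phiD phiZ phi_int phi_refl]] := max_embedding.
have [p [pE pm _]] := Snu_uniformizer.
have [fgW _ _ _] := fmax.
have phi0 : phi 0 = 0 by have := phiZ 0 0; rewrite scale0r Snu_series0 scale0r.
pose WL y := exists w, y = phi w.
have WL0 : WL 0 by exists 0.
have WLD x y : WL x -> WL y -> WL (x + y).
  by move=> [w ->] [w' ->]; exists (w + w'); rewrite phiD.
have WLZ s x : sge nu 0 s -> WL x -> WL (s *: x).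
  by move=> /Snu_seriesP[g <-] [w ->]; exists (g *: w); rewrite phiZ.
have WLint x : WL x -> forall k, sge nu 0 (x ord0 k) by move=> [w ->].
have [r [deg [e [rd e_deg e_gen]]]] := reflexive_generators WL0 WLD WLZ WLint phi_refl.
exists r => //.
have /choice[g gP] (i : 'I_r) : exists g : 'I_k -> powser {fraction R},
    (forall l, sge nu (- deg i) (g l)) /\
    forall s, sge nu (- deg i) s -> exists2 c : 'I_k -> powser {fraction R},
      forall l, sge nu 0 (c l) & s = \sum_l c l * g l.
  by have [g g1 g2] := monomial_gens R (- deg i) gens_k; exists g.
have /choice[G GE] (t : 'I_r * 'I_k) : exists w, g t.1 t.2 *: e t.1 = phi w.
  by apply: e_deg; have [] := gP t.1.
have [q qE] : exists q : S,
    Snu_series q = cst (pi%:F ^ (- numq nu)) * var _ ^+ `|denq nu|.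
  apply: Snu_seriesP; rewrite (_ : 0 = denq nu * - numq nu + numq nu * `|denq nu|%N%:Z).
    by apply: sgeM; [apply/sge_cst/kge_pi|apply: sge_varX].
  by rewrite gez0_abs ?denq_ge0 // mulrN mulrC addNr.
(* Although [q] has Gauss valuation zero, its constant term vanishes because [al >= 1]. *)
have qm : Snu_max q.
  rewrite /Snu_max qE cstME; have := denq_gt0 nu; case: (denq nu) => // -[|m] // _.
  by rewrite exprS varM0 mulr0; apply: kge0.
rewrite (_ : r * k = #|{: 'I_r * 'I_k}|)%N; last by rewrite card_prod !card_ord.
apply: (generated_by_card (G := G)); apply: (nakayama pm qm fgW) => w.
have [c [y1 [y2 [c_deg [w1 ->] [w2 ->] wE]]]] := e_gen _ (ex_intro _ w (erefl _)).
have /choice[a aE] (i : 'I_r) : exists a : 'I_k -> S,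
    c i = \sum_l Snu_series (a l) * g i l.
  have [b b0 ->] := (gP i).2 _ (c_deg i).
  have /choice[a aE] l : exists a : S, Snu_series a = b l by apply: Snu_seriesP.
  by exists a; apply: eq_bigr => l _; rewrite aE.
exists (fun t => a t.1 t.2), w1, w2; apply: phi_inj.
rewrite !phiD !phiZ wE pE qE; congr (_ + _ + _).
rewrite (big_morph phi phiD phi0).
transitivity (\sum_i \sum_l phi (a i l *: G (i, l))); last first.
  by rewrite pair_bigA; apply: eq_bigr => -[i l] _.
apply: eq_bigr => i _; rewrite aE scaler_suml; apply: eq_bigr => l _.
by rewrite phiZ -GE scalerA.
Qed.
End MaxEmbedding.

Theorem theorem1p2 (R : completeDvrType) (nu : rat) (d : nat) (hd : (0 < d)%N)
    (n : nat) (a : nat -> int)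
    (ha : forall i, (1 <= i <= n)%N -> 0 < a i)
    (han : (0 < n)%N -> a n != 1)
    (hnu : nu = cfrac a n)
    (M : submodClosed 'rV[Snu R nu]_d)
    (MaxM : lmodType (Snu R nu)) (f : {linear submodule M -> MaxM})
    (hMax : is_Max f) :
  exists k : nat,
    k%:Z <= d%:Z * (2 + \sum_(1 <= i < n./2.+1) a (2 * i)%N) /\
    generated_by MaxM k.
Proof.
have [k kb kg] := line_gens_cfrac ha; rewrite -hnu in kg.
have [r rd gen] := max_generated hMax kg.
exists (r * k)%N; split=> //; rewrite PoszM ler_pM //.
Qed.
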